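(* Let $\Gamma$ be a finite simplicial graph with vertex set $V$, and let $L\subseteq V$ be the set of principal vertices of $\Gamma$. Then $U(A_\Gamma)$ contains a free abelian subgroup of rank $M(L)$.
   Context: **Graphs and RAAGs.** $\Gamma$ is a finite simplicial graph with vertex set $V$; $A_\Gamma$ is the right-angled Artin group with generating set $V$ and relations $[v,w]=1$ whenever $v,w$ are adjacent. For a vertex $v$, $lk(v)$ is the set of vertices adjacent to $v$ and $st(v)=lk(v)\cup\{v\}$. $V^\pm=V\sqcup V^{-1}$ is the set of generators and their inverses; for $W\subseteq V$, $W^\pm$ is the set of elements of $W$ and their inverses. For $m\in V^\pm$, $lk(m),st(m)$ denote the link and star of the underlying vertex. For $m,n\in V^\pm$, $[m,n]=1$ means that $m,n$ commute in $A_\Gamma$ (the underlying vertices are equal or adjacent). **Principal vertices.** A vertex $v$ is principal if there is no vertex $w$ with $lk(v)\subsetneq lk(w)$. **Untwisted subgroup.** $U(A_\Gamma)\le Out(A_\Gamma)$ is the subgroup generated by the images of: inversions ($v\mapsto v^{-1}$, other generators fixed); graph automorphisms (induced by automorphisms of $\Gamma$); right folds $u\mapsto um$ and left folds $u\mapsto mu$ (other generators fixed), for distinct vertices with $lk(u)\subseteq lk(m)$; and partial conjugations ($v\mapsto m^{-1}vm$ for all $v\in C$, other generators fixed, where $C$ is a component of $\Gamma-st(m)$). **$\Gamma$W-partitions.** For $m\in V^\pm$ consider the components $C$ of $\Gamma-lk(m)$. A subset $U\subset V^\pm$ is $m$-inseparable if either $C=\{u\}$ for some component $C$ and $U=\{u\}$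 or $U=\{u^{-1}\}$ (this includes $u=m^{\pm1}$), or $U=C^\pm$ for a component $C$ with more than one vertex. $\mathbf I(m)$ is the collection of $m$-inseparable subsets. A $\Gamma$W-subset based at $m$ is a union $P$ of elements of $\mathbf I(m)$ with $m\in P$, $m^{-1}\notin P$; set $P^*=V^\pm\setminus lk(m)^\pm\setminus P$. The partition $\mathcal P=\{P\,|\,P^*\,|\,lk(m)^\pm\}$ of $V^\pm$ (unordered in $P,P^*$) is a $\Gamma$W-partition based at $m$ if $P$ is a $\Gamma$W-subset based at $m$ and both $P$ and $P^*$ have at least two elements; $P,P^*$ are its sides. It is then also based at $m^{-1}$, and we say it is based at the underlying vertex; a partition may be based at several vertices. **Compatibility.** $\Gamma$W-partitions $\mathcal P$ (based at $m$) and $\mathcal Q$ (based at $n$) are compatible if either (1) $P^\times\cap Q^\times=\emptyset$ for at least one choice of sides $P^\times\in\{P,P^*\}$, $Q^\times\in\{Q,Q^*\}$, or (2) $[m,n]=1$ and $st(m)\ne st(n)$. A compatible collection is a set of (distinct) pairwise compatible $\Gamma$W-partitions. For $U\subseteq V$, $M(U)$ is the largest possible size of a compatible collection of $\Gamma$W-partitions each of which is based at some $u\in U$. *)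

(* Defs.v *)
(* MathComp, with the classical axioms of mathcomp.classical (boolp). *)
From HB Require Import structures.
From mathcomp Require Import all_boot all_order all_algebra all_fingroup.
From mathcomp Require Import generic_quotient boolp classical_sets.

Set Implicit Arguments.
Unset Strict Implicit.
Unset Printing Implicit Defensive.

Local Open Scope classical_set_scope.
Local Open Scope quotient_scope.
Local Open Scope group_scope.

Record sgraph := SGraph {
  vertex :> finType;
  adj : rel vertex;
  adj_sym : symmetric adj;
  adj_irrefl : irreflexive adj }.
Arguments adj {s} _ _.

Section Links.
Variable G : sgraph.

Definition lk (v : G) : {set G} := [set w | adj v w]%SET.
Definition st (v : G) : {set G} := (v |: lk v)%SET.

Definition principal (v : G) : bool := ~~ [exists w, lk v \proper lk w].
Definition principal_set : {set G} := [set v | principal v]%SET.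

(* C is (the vertex set of) a connected component of G - A. *)
Definition is_component (A C : {set G}) : bool :=
  [exists u, (u \notin A) &&
    (C == [set w | connect
             [rel x y | [&& adj x y, x \notin A & y \notin A]] u w]%SET)].

(* V^pm: (v, true) stands for v and (v, false) for v^-1. *)
Definition lit : finType := (G * bool)%type.
Definition linv (x : lit) : lit := (x.1, ~~ x.2).
Definition pm (W : {set G}) : {set lit} := [set x : lit | x.1 \in W]%SET.

End Links.

Section Raag.
Variable G : sgraph.

(* The least congruence on words in V^pm with x x^-1 = 1 for x in V^pm, and
   v w = w v for adjacent vertices v, w. *)
Inductive word_eq : seq (lit G) -> seq (lit G) -> Prop :=
| word_eq_refl a : word_eq a a
| word_eq_sym a b : word_eq a b -> word_eq b a
| word_eq_trans a b c : word_eq a b -> word_eq b c -> word_eq a c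
| word_eq_cancel a b x : word_eq (a ++ [:: x; linv x] ++ b) (a ++ b)
| word_eq_comm a b v w : adj v w ->
    word_eq (a ++ [:: (v, true); (w, true)] ++ b)
            (a ++ [:: (w, true); (v, true)] ++ b).

Definition word_eqb (a b : seq (lit G)) : bool := `[< word_eq a b >].

Lemma word_eqb_refl : reflexive word_eqb.
Proof. by move=> a; apply/asboolP; exact: word_eq_refl. Qed.

Lemma word_eqb_sym : symmetric word_eqb.
Proof. by move=> a b; apply/asboolP/asboolP; exact: word_eq_sym. Qed.

Lemma word_eqb_trans : transitive word_eqb.
Proof.
move=> b a c /asboolP ab /asboolP bc; apply/asboolP.
exact: word_eq_trans ab bc.
Qed.

Canonical word_equiv := EquivRel word_eqb word_eqb_refl word_eqb_sym
  word_eqb_trans.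

Definition raag : Type := {eq_quot word_equiv}.
HB.instance Definition _ := Choice.on raag.
HB.instance Definition _ := Quotient.on raag.

Definition raag_mul (x y : raag) : raag := \pi_raag (repr x ++ repr y).
Definition raag_one : raag := \pi_raag [::].
Definition raag_inv (x : raag) : raag :=
  \pi_raag (rev (map (@linv G) (repr x))).

Lemma raag_piE a b : word_eq a b <-> \pi_raag a = \pi_raag b.
Proof.
split=> [ab|ab]; first by apply/eqmodP/asboolP.
by move/eqmodP: ab => /asboolP.
Qed.

Lemma word_eq_ctx c d a b : word_eq a b -> word_eq (c ++ a ++ d) (c ++ b ++ d).
Proof.
elim=> {a b} [a|a b _ ab|a b e _ ab _ be|a b x|a b v w vw].
- exact: word_eq_refl.
- exact: word_eq_sym.
- exact: word_eq_trans ab be.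
- by have := word_eq_cancel (c ++ a) (b ++ d) x; rewrite -!catA.
- by have := word_eq_comm (c ++ a) (b ++ d) vw; rewrite -!catA.
Qed.

Lemma word_eq_cat a a' b b' :
  word_eq a a' -> word_eq b b' -> word_eq (a ++ b) (a' ++ b').
Proof.
move=> aa bb; apply: (@word_eq_trans _ (a' ++ b)).
  exact: (word_eq_ctx [::] b aa).
by have := word_eq_ctx a' [::] bb; rewrite !cats0.
Qed.

Lemma linvK : involutive (@linv G).
Proof. by case=> v s; rewrite /linv /= negbK. Qed.

Lemma word_eq_mulV a : word_eq (a ++ rev (map (@linv G) a)) [::].
Proof.
elim/last_ind: a => [|a x IH]; first exact: word_eq_refl.
rewrite map_rcons rev_rcons -cats1 -catA.
exact: word_eq_trans (word_eq_cancel a _ x) IH.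
Qed.

Lemma word_eq_mulVl a : word_eq (rev (map (@linv G) a) ++ a) [::].
Proof.
have := word_eq_mulV (rev (map (@linv G) a)).
by rewrite map_rev revK -map_comp (eq_map (linvK : _ =1 id)) map_id.
Qed.

Lemma repr_pi_eq a : word_eq (repr (\pi_raag a)) a.
Proof. by apply/raag_piE; rewrite reprK. Qed.

Lemma raag_mulE a b : raag_mul (\pi_raag a) (\pi_raag b) = \pi_raag (a ++ b).
Proof. by apply/raag_piE/word_eq_cat; exact: repr_pi_eq. Qed.

Lemma raag_mulA : associative raag_mul.
Proof.
move=> x y z; rewrite -[x]reprK -[y]reprK -[z]reprK.
by rewrite (raag_mulE (repr y) (repr z)) (raag_mulE (repr x) (repr y)) !raag_mulE catA.
Qed.

Lemma raag_mul1 : left_id raag_one raag_mul.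
Proof. by move=> x; rewrite -[x]reprK raag_mulE. Qed.

Lemma raag_1mul : right_id raag_one raag_mul.
Proof. by move=> x; rewrite -[x]reprK raag_mulE cats0. Qed.

Lemma raag_mulV : left_inverse raag_one raag_inv raag_mul.
Proof.
move=> x; rewrite -{2}[x]reprK /raag_inv raag_mulE.
exact/raag_piE/word_eq_mulVl.
Qed.

Lemma raag_Vmul : right_inverse raag_one raag_inv raag_mul.
Proof.
move=> x; rewrite -{1}[x]reprK /raag_inv raag_mulE.
exact/raag_piE/word_eq_mulV.
Qed.

HB.instance Definition _ := isGroup.Build raag
  raag_mulA raag_mul1 raag_1mul raag_mulV raag_Vmul.

Definition gen (v : G) : raag := \pi_raag [:: (v, true)].

End Raag.

Section OuterAut.
Variable A : groupType.

Definition is_aut (f : A -> A) : Prop :=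
  {morph f : x y / x * y} /\ bijective f.

Record aut := Aut { aut_fun :> A -> A; autP : `[< is_aut aut_fun >] }.
HB.instance Definition _ := [isSub for aut_fun].
HB.instance Definition _ := [Choice of aut by <:].

Lemma autM (f : aut) : {morph f : x y / x * y}.
Proof. by case: f => f /= /asboolP[]. Qed.

Lemma aut_bij (f : aut) : bijective f.
Proof. by case: f => f /= /asboolP[]. Qed.

Lemma aut_inv_ex (f : aut) : exists g : A -> A, cancel f g /\ cancel g f.
Proof. by case: (aut_bij f) => g fg gf; exists g. Qed.

Definition aut_inv_fun (f : aut) : A -> A := projT1 (cid (aut_inv_ex f)).

Lemma aut_funK (f : aut) : cancel f (aut_inv_fun f).
Proof. by rewrite /aut_inv_fun; case: cid => g []. Qed.

Lemma aut_inv_funK (f : aut) : cancel (aut_inv_fun f) f.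
Proof. by rewrite /aut_inv_fun; case: cid => g []. Qed.

Lemma aut_one_subproof : `[< is_aut (@id A) >].
Proof. by apply/asboolP; split=> //; exists id. Qed.
Definition aut_one : aut := Aut aut_one_subproof.

Lemma aut_mul_subproof (f g : aut) : `[< is_aut (f \o g) >].
Proof.
apply/asboolP; split=> [x y|]; first by rewrite /= !autM.
exact: bij_comp (aut_bij f) (aut_bij g).
Qed.
Definition aut_mul (f g : aut) : aut := Aut (aut_mul_subproof f g).

Lemma aut_inv_subproof (f : aut) : `[< is_aut (aut_inv_fun f) >].
Proof.
apply/asboolP; split=> [x y|].
  by apply: (bij_inj (aut_bij f)); rewrite autM !aut_inv_funK.
by exists f; [exact: aut_inv_funK | exact: aut_funK].
Qed.
Definition aut_inv (f : aut) : aut := Aut (aut_inv_subproof f).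

Lemma autE (f g : aut) : f =1 g -> f = g.
Proof. by move=> fg; apply: val_inj; apply/funext. Qed.

Lemma aut_mulA : associative aut_mul. Proof. by move=> f g h; exact: autE. Qed.
Lemma aut_mul1 : left_id aut_one aut_mul. Proof. by move=> f; exact: autE. Qed.
Lemma aut_1mul : right_id aut_one aut_mul. Proof. by move=> f; exact: autE. Qed.
Lemma aut_mulV : left_inverse aut_one aut_inv aut_mul.
Proof. by move=> f; apply: autE => x /=; rewrite aut_funK. Qed.
Lemma aut_Vmul : right_inverse aut_one aut_inv aut_mul.
Proof. by move=> f; apply: autE => x /=; rewrite aut_inv_funK. Qed.

HB.instance Definition _ := isGroup.Build aut
  aut_mulA aut_mul1 aut_1mul aut_mulV aut_Vmul.

Definition inner (f : aut) : Prop := exists g : A, forall x, f x = x ^ g.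

Lemma inner1 : inner 1.
Proof. by exists 1 => x; rewrite conjg1. Qed.

Lemma innerM f g : inner f -> inner g -> inner (f * g).
Proof.
move=> [a fa] [b gb]; exists (b * a) => x.
by rewrite conjgM -gb -fa.
Qed.

Lemma innerV f : inner f -> inner f^-1.
Proof.
move=> [a fa]; exists a^-1 => x; apply: (bij_inj (aut_bij f)).
by rewrite [LHS]aut_inv_funK fa conjgKV.
Qed.

Lemma innerJ f g : inner f -> inner (f ^ g).
Proof.
move=> [a fa]; exists (g^-1 a) => x.
apply: (bij_inj (aut_bij g)).
have gK y : g (g^-1 y) = y by exact: aut_inv_funK.
have gV y : g y^-1 = (g y)^-1.
  apply: (mulgI (g y)); rewrite -autM !mulgV.
  by apply: (mulgI (g 1)); rewrite -autM !mulg1.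
transitivity (f (g x)); first exact: gK.
by rewrite fa /conjg !autM gV gK.
Qed.

Definition out_eqb (f g : aut) : bool := `[< inner (f^-1 * g) >].

Lemma out_eqb_refl : reflexive out_eqb.
Proof. by move=> f; apply/asboolP; rewrite mulVg; exact: inner1. Qed.

Lemma out_eqb_sym : symmetric out_eqb.
Proof.
by move=> f g; apply/asboolP/asboolP => /innerV; rewrite invgM invgK.
Qed.

Lemma out_eqb_trans : transitive out_eqb.
Proof.
move=> g f h /asboolP fg /asboolP gh; apply/asboolP.
by have := innerM fg gh; rewrite mulgA mulgK.
Qed.

Canonical out_equiv := EquivRel out_eqb out_eqb_refl out_eqb_sym out_eqb_trans.

Definition out : Type := {eq_quot out_equiv}.
HB.instance Definition _ := Choice.on out.
HB.instance Definition _ := Quotient.on out.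

Definition out_mul (x y : out) : out := \pi_out (repr x * repr y).
Definition out_one : out := \pi_out 1.
Definition out_inv (x : out) : out := \pi_out (repr x)^-1.

Lemma out_piE f g : inner (f^-1 * g) <-> \pi_out f = \pi_out g.
Proof.
split=> [fg|fg]; first by apply/eqmodP/asboolP.
by move/eqmodP: fg => /asboolP.
Qed.

Lemma out_mulE f g : out_mul (\pi_out f) (\pi_out g) = \pi_out (f * g).
Proof.
apply/out_piE; set f' := repr _; set g' := repr _.
have ff : inner (f'^-1 * f) by apply/out_piE; rewrite reprK.
have gg : inner (g'^-1 * g) by apply/out_piE; rewrite reprK.
suff -> : (f' * g')^-1 * (f * g) = (g'^-1 * g) * (f'^-1 * f) ^ g.
  exact: innerM gg (innerJ _ ff).
by rewrite /conjg invgM !mulgA mulgK.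
Qed.

Lemma out_mulA : associative out_mul.
Proof.
move=> x y z; rewrite -[x]reprK -[y]reprK -[z]reprK.
by rewrite (out_mulE (repr y) (repr z)) (out_mulE (repr x) (repr y)) !out_mulE mulgA.
Qed.

Lemma out_mul1 : left_id out_one out_mul.
Proof. by move=> x; rewrite -[x]reprK out_mulE mul1g. Qed.

Lemma out_1mul : right_id out_one out_mul.
Proof. by move=> x; rewrite -[x]reprK out_mulE mulg1. Qed.

Lemma out_mulV : left_inverse out_one out_inv out_mul.
Proof. by move=> x; rewrite -{2}[x]reprK /out_inv out_mulE mulVg. Qed.

Lemma out_Vmul : right_inverse out_one out_inv out_mul.
Proof. by move=> x; rewrite -{1}[x]reprK /out_inv out_mulE mulgV. Qed.

HB.instance Definition _ := isGroup.Build out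
  out_mulA out_mul1 out_1mul out_mulV out_Vmul.

End OuterAut.

Section Subgroups.
Variable A : groupType.

Definition is_subgroup (H : set A) : Prop := group_closed (mem H).

Definition generated (S : set A) : set A := smallest is_subgroup S.

Definition free_abelian_subgroup (r : nat) (H : set A) : Prop :=
  is_subgroup H /\
  exists f : 'rV[int]_r -> A,
    [/\ {morph f : x y / (x + y)%R >-> x * y}, injective f & range f = H].

End Subgroups.

(* An automorphism of the RAAG is determined by its values on the generators,
   so each class of generators of U is described by these values. *)
Section Untwisted.
Variable G : sgraph.
Implicit Type phi : aut (raag G).

Definition is_inversion phi : Prop :=
  exists v : G, phi (gen v) = (gen v)^-1 /\
    forall w, w != v -> phi (gen w) = gen w.

Definition is_graph_aut phi : Prop :=
  exists s : {perm G}, (forall v w, adj (s v) (s w) = adj v w) /\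
    forall v, phi (gen v) = gen (s v).

Definition is_right_fold phi : Prop :=
  exists u m : G, [/\ u != m, lk u \subset lk m,
    phi (gen u) = gen u * gen m &
    forall w, w != u -> phi (gen w) = gen w].

Definition is_left_fold phi : Prop :=
  exists u m : G, [/\ u != m, lk u \subset lk m,
    phi (gen u) = gen m * gen u &
    forall w, w != u -> phi (gen w) = gen w].

Definition is_partial_conj phi : Prop :=
  exists (m : G) (C : {set G}), [/\ is_component (st m) C,
    forall v, v \in C -> phi (gen v) = (gen m)^-1 * gen v * gen m &
    forall v, v \notin C -> phi (gen v) = gen v].

Definition untwisted_gen : set (aut (raag G)) :=
  [set phi | [\/ is_inversion phi, is_graph_aut phi,
     is_right_fold phi \/ is_left_fold phi | is_partial_conj phi]].

Definition untwisted : set (out (raag G)) :=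
  generated [set \pi_(out (raag G)) phi | phi in untwisted_gen].

End Untwisted.
Arguments untwisted : clear implicits.

Section Partitions.
Local Close Scope classical_set_scope.
Variable G : sgraph.

Definition inseparable (m : lit G) (U : {set lit G}) : bool :=
  [exists C : {set G}, is_component (lk m.1) C &&
    ([exists u, (C == [set u])
                && ((U == [set (u, true)]) || (U == [set (u, false)]))]
     || (1 < #|C|) && (U == pm C))].

Definition gw_subset (m : lit G) (P : {set lit G}) : bool :=
  [&& [exists S : {set {set lit G}},
         [forall U in S, inseparable m U] && (P == finset.cover S)],
      m \in P & linv m \notin P].

Definition dual_side (m : lit G) (P : {set lit G}) : {set lit G} :=
  ~: pm (lk m.1) :\: P.

(* A candidate {P | P* | lk(m)^pm}, unordered in its sides P and P*, is encoded
   as the pair of {P, P*} and lk(m)^pm. *)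
Definition gwpart : finType := ({set {set lit G}} * {set lit G})%type.
Definition sides (p : gwpart) : {set {set lit G}} := p.1.

Definition based_at (m : lit G) (p : gwpart) : bool :=
  [exists P : {set lit G},
    [&& gw_subset m P, 1 < #|P|, 1 < #|dual_side m P| &
        p == ([set P; dual_side m P], pm (lk m.1))]].

Definition is_gwpart (p : gwpart) : bool := [exists m, based_at m p].

Definition based_at_vertex (v : G) (p : gwpart) : bool :=
  based_at (v, true) p || based_at (v, false) p.

(* [m, n] = 1 in the RAAG. *)
Definition lit_commute (m n : lit G) : bool := (m.1 == n.1) || adj m.1 n.1.

(* The second alternative does not depend on the choice of the bases m of p and n of q. *)
Definition compatible (p q : gwpart) : bool :=
  [exists P in sides p, [exists Q in sides q, [disjoint P & Q]]]
  || [exists m, [exists n, [&& based_at m p, based_at n q,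
                               lit_commute m n & st m.1 != st n.1]]].

Definition compatible_collection (S : {set gwpart}) : bool :=
  [forall p in S, is_gwpart p]
  && [forall p in S, [forall q in S, (p != q) ==> compatible p q]].

Definition M (U : {set G}) : nat :=
  \max_(S : {set gwpart} | compatible_collection S
      && [forall p in S, [exists u in U, based_at_vertex u p]]) #|S|.

End Partitions.

(* Main.v *)
From HB Require Import structures.
Require Import Defs.
From mathcomp Require Import boolp classical_sets.
From mathcomp Require Import all_boot all_order all_algebra all_fingroup.
From mathcomp Require Import generic_quotient.
From mathcomp Require Import zify ring.

(** The idea is to turn a compatible collection S of partitions with principal
    bases into as many commuting twists, not partition by partition but by
    counting.

    For a vertex m and an integer f(l) for each literal l off the star of m,
    the twist by f sends a generator u to m^-f(u) u m^f(u^-1). It is an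
    automorphism as soon as f is constant on the literals of each component
    with more than one vertex, and it is then a product of folds and partial
    conjugations by m, so its outer class is untwisted
    ([outer_twist_indicator]). Twists with the same base add up, and constant
    functions give inner automorphisms. Twists by f at m and by g at n commute
    in Aut if m and n are adjacent; if they are neither equal nor adjacent,
    they commute in Out as soon as every literal off both stars has the f-value
    of n or the g-value of m ([outer_twist_commute_far]): after a shift by
    constants, f and g have disjoint supports.

    Group the partitions of S by the link of their bases and choose one base m
    for each link. Tie together two literals off the link of m when their
    vertices are adjacent, and also when neither has the link of m and both lie
    on the same side as a chosen base n, off the star of m, for each of the k
    partitions of the group of m. Twists that are constant on the tied classes
    satisfy the commutation criterion for any two bases ([conn_far]): a literal
    that is tied neither to n for m nor to m for n would be separated from n by
    some partition p of the group of m, and from m by some partition q of the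
    group of n, and then each side of p would meet each side of q.

    There are enough classes. A literal whose vertex has the link of m is a
    class by itself, and each side of a partition of the group contains such a
    literal and another one, hence at least two classes. So the k partitions
    are pairwise nested splittings of the set of classes with at least two
    classes on each side, like the inner edges of a tree whose leaves are the
    classes, and such a family has at most (number of classes) - 3 members
    ([laminar_bound], [card_free_reps]). Leaving out the classes of m and m^-1
    and one more class, there remain k classes; their indicator functions give
    k twists at m, and altogether as many twists as there are partitions in S.

    These twists are independent in Out ([family_map_ker]). If a product of
    twists, at most one for each base, is inner, then exponent sums show that
    each of them conjugates the generators, and the class-two nilpotent
    quotients m -> X, u -> Y onto the integral Heisenberg group read off the
    conjugating exponents, which at the base m all equal the exponent sum of m
    in the element that induces the inner automorphism; so each function is
    constant off the star of its base ([twist_product_constant]). It vanishes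
    on the class left out, hence everywhere. *)

Set Implicit Arguments.
Unset Strict Implicit.
Unset Printing Implicit Defensive.

Import GRing.Theory.
Local Open Scope quotient_scope.
Local Open Scope group_scope.

(** * Laminar families *)

Section Laminar.
Variable T : finType.
Implicit Types (A B E : {set T}) (F : {set {set T}}).

Definition laminar F := forall A B, A \in F -> B \in F ->
  [\/ A \subset B, B \subset A | [disjoint A & B]].

(** Remove from E a point a of a minimal member A. The members other than A
    stay distinct, since one that contains a contains A while one that avoids a
    avoids A, and they keep two points, since those containing a are larger
    than A. *)
Lemma laminar_bound F E : laminar F ->
  (forall A, A \in F -> A \subset E /\ 1 < #|A|) -> #|F| <= #|E|.-1.
Proof.
elim: {F}_.+1 {-2}F (ltnSn #|F|) E => // k IH F leFk E lamF FE.
have [->|/set0Pn[A0 A0F]] := eqVneq F set0; first by rewrite cards0.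
have [A /minsetP[AF minA] _] := minset_exists (P := fun B => B \in F) A0F.
have [/subsetP AE A_gt1] := FE A AF.
have /card_gt0P[a aA] : 0 < #|A| by apply: ltnW.
pose F' := [set B :\ a | B in F :\ A].
have subA B : B \in F -> a \in B -> A \subset B.
  move=> BF aB; case: (lamF A B AF BF) => // [BA|/disjointFr/(_ aA)].
    by rewrite (minA B BF BA).
  by rewrite aB.
have disjA B : B \in F -> a \notin B -> [disjoint A & B].
  move=> BF aB; case: (lamF A B AF BF) => // [/subsetP/(_ a aA)|BA].
    by rewrite (negPf aB).
  by rewrite -(minA B BF BA) (negPf aB) in aA *.
(* B contains A, so its trace and hence B' meet A; then B' cannot avoid a. *)
have half B B' : B \in F -> B' \in F -> B :\ a = B' :\ a -> a \in B -> a \in B'.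
  move=> BF B'F eqB aB; apply: contraT => aB'.
  have /card_gt1P[x [y [xA yA xy]]] := A_gt1.
  have [z zA za] : exists2 z, z \in A & z != a.
    by have [xa|xa] := eqVneq x a; [exists y; rewrite // eq_sym -xa | exists x].
  have : z \in B' :\ a by rewrite -eqB !inE za (subsetP (subA B BF aB)).
  by rewrite !inE za (disjointFr (disjA B' B'F aB') zA).
have injF : {in F :\ A &, injective (fun B => B :\ a)}.
  move=> B B' /setD1P[_ BF] /setD1P[_ B'F] eqB.
  have aBB' : (a \in B) = (a \in B').
    by apply/idP/idP; apply: half.
  apply/setP=> z; have [->//|za] := eqVneq z a.
  by have /setP/(_ z) := eqB; rewrite !inE za.
have cF' : #|F| = #|F'|.+1 by rewrite card_in_imset // (cardsD1 A F) AF.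
have cE : #|E| = #|E :\ a|.+1 by rewrite (cardsD1 a E) AE.
have E_gt1 : 1 < #|E| by apply: leq_trans A_gt1 (subset_leq_card _);
  apply/subsetP.
rewrite cF' cE; suff: #|F'| <= #|E :\ a|.-1 by rewrite cE in E_gt1; lia.
apply: IH; first by rewrite -ltnS -cF'.
- move=> _ _ /imsetP[B /setD1P[_ BF] ->] /imsetP[C /setD1P[_ CF] ->].
  case: (lamF B C BF CF) => BC; [constructor 1 | constructor 2 | constructor 3].
  + exact: setSD.
  + exact: setSD.
  + by apply: disjointWl (subsetDl _ _) (disjointWr (subsetDl _ _) BC).
- move=> _ /imsetP[B /setD1P[BA BF] ->].
  have [BE B_gt1] := FE B BF; split; first exact: setSD.
  have := cardsD1 a B; case: (boolP (a \in B)) => aB; last by lia.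
  have : A \proper B by rewrite properEneq eq_sym BA subA.
  by move/proper_card; lia.
Qed.

End Laminar.

(** * Integer powers and morphisms *)

Section Powers.
Variable A : groupType.
Implicit Types (x y : A) (z : int).

Definition zpow x z : A :=
  match z with Posz n => x ^+ n | Negz n => x ^- n.+1 end.

Lemma zpow0 x : zpow x 0 = 1. Proof. by []. Qed.
Lemma zpow1 x : zpow x 1 = x. Proof. exact: expg1. Qed.

Lemma zpowS x z : zpow x (z + 1)%R = zpow x z * x.
Proof.
case: z => [n|[|n]]; last 1 first.
- have -> : (Negz n.+1 + 1 = Negz n)%R by lia.
  by rewrite /= (expgS x n.+1) invgM mulgVK.
- have -> : (Posz n + 1 = Posz n.+1)%R by lia.
  by rewrite /= expgSr.
- by rewrite /= expg1 mulVg.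
Qed.

Lemma zpowB1 x z : zpow x (z - 1)%R = zpow x z * x^-1.
Proof. by rewrite -{2}[z](subrK 1%R) zpowS mulgK. Qed.

Lemma zpowD x : {morph zpow x : y z / (y + z)%R >-> y * z}.
Proof.
move=> y; elim/int_rect=> [|n IH|n IH]; first by rewrite addr0 mulg1.
  by rewrite intS (addrC 1%R) addrA !zpowS IH mulgA.
by rewrite intS (addrC 1%R) opprD addrA !zpowB1 IH mulgA.
Qed.

Lemma zpowN x z : zpow x (- z)%R = (zpow x z)^-1.
Proof. by apply: (mulIg (zpow x z)); rewrite -zpowD addNr mulVg. Qed.

Lemma commute_zpow x y z : commute y x -> commute y (zpow x z).
Proof. by case: z => n yx; [|apply: commuteV]; apply: commuteX. Qed.

End Powers.

Section Morphisms.
Variables (A B : groupType) (f : A -> B).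
Hypothesis fM : {morph f : x y / x * y}.

Lemma morph_one : f 1 = 1.
Proof. by apply: (mulgI (f 1)); rewrite -fM !mulg1. Qed.

Lemma morph_inv x : f x^-1 = (f x)^-1.
Proof. by apply: (mulgI (f x)); rewrite -fM !mulgV morph_one. Qed.

Lemma morph_exp x n : f (x ^+ n) = f x ^+ n.
Proof. by elim: n => [|n IH]; rewrite ?expg0 ?morph_one // !expgS fM IH. Qed.

Lemma morph_zpow x z : f (zpow x z) = zpow (f x) z.
Proof. by case: z => n; rewrite /= ?morph_inv morph_exp. Qed.

Lemma morph_conj x y : f (x ^ y) = f x ^ f y.
Proof. by rewrite !conjgE !fM morph_inv. Qed.

End Morphisms.

(** * Homomorphisms out of a right-angled Artin group *)

Section UniversalProperty.
Variable G : sgraph.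

Lemma mul_raagE (a b : seq (lit G)) :
  \pi_(raag G) a * \pi_(raag G) b = \pi_(raag G) (a ++ b).
Proof. exact: raag_mulE. Qed.

Lemma inv_gen (v : G) : (gen v)^-1 = \pi_(raag G) [:: (v, false)].
Proof.
apply: (mulgI (gen v)); rewrite mulgV mul_raagE; symmetry.
by apply/raag_piE; exact: (word_eq_cancel [::] [::] (v, true)).
Qed.

Lemma commute_gen (v w : G) : adj v w -> commute (gen v) (gen w).
Proof.
move=> vw; rewrite /commute !mul_raagE.
by apply/raag_piE; exact: (word_eq_comm [::] [::] vw).
Qed.

Lemma raag_ind (P : raag G -> Prop) : P 1 ->
  (forall v x, P x -> P (gen v * x)) ->
  (forall v x, P x -> P ((gen v)^-1 * x)) -> forall x, P x.
Proof.
move=> P1 Pgen PgenV x; rewrite -[x]reprK.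
elim: (repr x) => [|[v b] w IH]; first exact: P1.
have -> : \pi_(raag G) ((v, b) :: w) =
  \pi_(raag G) [:: (v, b)] * \pi_(raag G) w.
  by rewrite mul_raagE.
case: b; first exact: Pgen.
by rewrite -inv_gen; apply: PgenV.
Qed.

Lemma raag_hom_ext (A : groupType) (f g : raag G -> A) :
  {morph f : x y / x * y} -> {morph g : x y / x * y} ->
  (forall v, f (gen v) = g (gen v)) -> f =1 g.
Proof.
move=> fM gM fg; elim/raag_ind=> [|v x IH|v x IH].
- by rewrite (morph_one fM) (morph_one gM).
- by rewrite fM gM fg IH.
- by rewrite fM gM (morph_inv fM) (morph_inv gM) fg IH.
Qed.

Section Lift.
Variables (A : groupType) (h : G -> A).

Definition letter_val (l : lit G) : A := if l.2 then h l.1 else (h l.1)^-1.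
Definition word_val (w : seq (lit G)) : A := \prod_(l <- w) letter_val l.
Definition raag_lift (x : raag G) : A := word_val (repr x).

Hypothesis h_comm : forall v w, adj v w -> commute (h v) (h w).

Lemma word_val_eq a b : word_eq a b -> word_val a = word_val b.
Proof.
elim=> {a b} // [a b c _ -> _ -> //|a b [v s]|a b v w vw];
  rewrite /word_val !big_cat /= !big_cons; congr (_ * _).
  by rewrite big_nil mulg1; case: s; rewrite /letter_val /= ?mulgV ?mulVg mul1g.
by rewrite big_nil !mulg1 /letter_val /= h_comm.
Qed.

Lemma raag_lift_pi w : raag_lift (\pi_(raag G) w) = word_val w.
Proof. by apply: word_val_eq; apply: repr_pi_eq. Qed.

Lemma raag_liftM : {morph raag_lift : x y / x * y}.
Proof.
move=> x y; rewrite -[x]reprK -[y]reprK mul_raagE !raag_lift_pi.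
by rewrite /word_val big_cat.
Qed.

Lemma raag_lift_gen v : raag_lift (gen v) = h v.
Proof. by rewrite raag_lift_pi /word_val big_seq1. Qed.

End Lift.
End UniversalProperty.

(** * Twists by powers of a generator *)

Section Twists.
Variable G : sgraph.
Implicit Types (m n u v w : G) (f g : lit G -> int).

Lemma in_lk v w : (w \in lk v) = adj v w. Proof. by rewrite inE. Qed.
Lemma in_st v w : (w \in st v) =
  (w == v) || adj v w. Proof. by rewrite !inE. Qed.

(** For f the indicator function of a set P of literals, this multiplies the
    ends in P by m, as a Whitehead automorphism does; integer values cover all
    products of such automorphisms at once. *)
Definition twist_gen m f v : raag G :=
  if v \in st m then gen v
  else zpow (gen m) (- f (v, true)) * gen v * zpow (gen m) (f (v, false)).

Definition twist m f : raag G -> raag G := raag_lift (twist_gen m f).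

(** Constancy of f on the literals of each component of the complement of st m
    with more than one vertex: all these generators are then conjugated by the
    same power of m, so that adjacent ones still commute. *)
Definition admissible m f := forall v w b c,
  v \notin st m -> w \notin st m -> adj v w -> f (v, b) = f (w, c).

Lemma twist_gen_comm m f : admissible m f ->
  forall v w, adj v w -> commute (twist_gen m f v) (twist_gen m f w).
Proof.
move=> adm v w vw; rewrite /twist_gen.
have cvw := commute_gen vw.
case: ifPn => vm; case: ifPn => wm //.
- have vm' : adj m v.
    by move: vm wm; rewrite !in_st => /orP[/eqP<-|//]; rewrite vw orbT.
  have cv z : commute (gen v) (zpow (gen m) z).
    by apply/commute_zpow/commute_sym/commute_gen.
  by apply: commuteM => //; apply: commuteM.
- have wm' : adj m w.
    by move: wm vm; rewrite !in_st => /orP[/eqP<-|//];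
      rewrite (adj_sym w v) vw orbT.
  have cw z : commute (gen w) (zpow (gen m) z).
    by apply/commute_zpow/commute_sym/commute_gen.
  by apply/commute_sym; apply: commuteM => //; apply: commuteM => //;
    apply/commute_sym.
- have e b c : f (v, b) = f (w, c) by apply: adm.
  rewrite -(e true true) -(e true false) -(adm w v true false) // 1?adj_sym //.
  rewrite -(e true true) zpowN; set x := zpow _ _.
  have := congr1 (conjg^~ x) cvw; rewrite !conjMg /conjg !mulgA.
  by rewrite /commute !mulgA.
Qed.

Section OneBase.
Variable m : G.

Lemma twistM f : admissible m f -> {morph twist m f : x y / x * y}.
Proof. by move=> adm; apply: raag_liftM; apply: twist_gen_comm. Qed.

Lemma twist_genE f v : admissible m f -> twist m f (gen v) = twist_gen m f v.
Proof. by move=> adm; apply: raag_lift_gen; apply: twist_gen_comm. Qed.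

Lemma twist_fix f v : admissible m f -> v \in st m -> twist m f (gen v) = gen v.
Proof. by move=> adm vm; rewrite twist_genE // /twist_gen vm. Qed.

Lemma twist_zpow f v z : admissible m f -> v \in st m ->
  twist m f (zpow (gen v) z) = zpow (gen v) z.
Proof. by move=> adm vm; rewrite (morph_zpow (twistM adm)) twist_fix. Qed.

Lemma admissibleD f g : admissible m f -> admissible m g ->
  admissible m (fun l => f l + g l)%R.
Proof.
move=> fa ga v w b c vm wm vw.
by rewrite (fa _ _ b c vm wm vw) (ga _ _ b c vm wm vw).
Qed.

Lemma admissibleN f : admissible m f -> admissible m (fun l => - f l)%R.
Proof. by move=> fa v w b c vm wm vw; rewrite (fa _ _ b c vm wm vw). Qed.

Lemma admissible_cst (c : int) : admissible m (fun=> c).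
Proof. by []. Qed.

Lemma twistD f g : admissible m f -> admissible m g ->
  twist m f \o twist m g =1 twist m (fun l => f l + g l)%R.
Proof.
move=> fa ga; have fga := admissibleD fa ga.
apply: raag_hom_ext; [|exact: twistM|].
  by move=> x y; rewrite /= (twistM ga) (twistM fa).
move=> v /=; rewrite !twist_genE // /twist_gen.
case: ifPn => vm; first exact: twist_fix.
have mm : m \in st m by rewrite in_st eqxx.
rewrite !(twistM fa) !twist_zpow // twist_genE // /twist_gen (negPf vm).
by rewrite opprD addrC !zpowD !mulgA.
Qed.

Lemma eq_twist f g : admissible m f -> admissible m g ->
  (forall l, l.1 \notin st m -> f l = g l) -> twist m f =1 twist m g.
Proof.
move=> fa ga fg; apply: raag_hom_ext; try exact: twistM.
move=> v; rewrite !twist_genE // /twist_gen; case: ifPn => // vm.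
by rewrite !fg.
Qed.

Lemma twist0 : twist m (fun=> 0%R) =1 id.
Proof.
apply: raag_hom_ext => // [|v]; first exact/twistM/admissible_cst.
by rewrite twist_genE // /twist_gen oppr0 zpow0 mul1g mulg1 if_same.
Qed.

Lemma twist_is_aut f : admissible m f -> is_aut (twist m f).
Proof.
move=> fa; split; first exact: twistM.
have fN := admissibleN fa.
exists (twist m (fun l => - f l)%R) => x.
  rewrite -[LHS]/((_ \o _) x) twistD // -[RHS]twist0; apply: eq_twist => //.
    exact: admissibleD.
  by move=> l _; rewrite addNr.
rewrite -[LHS]/((_ \o _) x) twistD // -[RHS]twist0; apply: eq_twist => //.
  exact: admissibleD.
by move=> l _; rewrite addrN.
Qed.

(** Conjugation by a power of m fixes the generators in st m, as a twist does.
    *)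
Lemma twist_cst (c : int) x : twist m (fun=> c) x = x ^ zpow (gen m) c.
Proof.
have ca := admissible_cst c.
apply: (raag_hom_ext (g := fun y => y ^ zpow (gen m) c)) => [|y z|v] {x};
  [exact: twistM|exact: conjMg|].
rewrite twist_genE // /twist_gen zpowN; case: ifPn => vm; last first.
  by rewrite conjgE mulgA.
have cv : commute (gen v) (zpow (gen m) c).
  apply: commute_zpow; move: vm; rewrite in_st.
  by case/orP=> [/eqP->//|/commute_gen/commute_sym].
by rewrite conjgE cv mulKg.
Qed.

End OneBase.

(** The default value 1 is reached only if f is not admissible. *)
Definition twist_aut m f : Defs.aut (raag G) := insubd (1 :
  Defs.aut (raag G)) (twist m f).

Lemma twist_autE m f : admissible m f -> twist_aut m f =1 twist m f.
Proof.
by move=> fa x; rewrite /twist_aut -[aut_fun _]/(val _) insubdK //;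
  apply/asboolP/twist_is_aut.
Qed.

End Twists.

(** * Heisenberg quotients and the independence of twists *)

Section Heisenberg.

(** The triple (a, b, c) is the upper unitriangular matrix of size 3 with a and
    b above the diagonal and c in the corner. *)
Definition heis : Type := (int * int * int)%type.
HB.instance Definition _ := Choice.on heis.

Implicit Types x y z : heis.
Definition heis_mul x y : heis :=
  (x.1.1 + y.1.1, x.1.2 + y.1.2, x.2 + y.2 + x.1.1 * y.1.2)%R.
Definition heis_one : heis := (0, 0, 0)%R.
Definition heis_inv x : heis :=
  (- x.1.1, - x.1.2, - x.2 + x.1.1 * x.1.2)%R.

Lemma heis_mulA : associative heis_mul.
Proof. by move=> x y z; rewrite /heis_mul /=; congr (_, _, _); ring. Qed.
Lemma heis_mul1 : left_id heis_one heis_mul.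
Proof. by case=> [[a b] c]; rewrite /heis_mul /=; congr (_, _, _); ring. Qed.
Lemma heis_1mul : right_id heis_one heis_mul.
Proof. by case=> [[a b] c]; rewrite /heis_mul /=; congr (_, _, _); ring. Qed.
Lemma heis_mulV : left_inverse heis_one heis_inv heis_mul.
Proof. by case=> [[a b] c]; rewrite /heis_mul /=; congr (_, _, _); ring. Qed.
Lemma heis_Vmul : right_inverse heis_one heis_inv heis_mul.
Proof. by case=> [[a b] c]; rewrite /heis_mul /=; congr (_, _, _); ring. Qed.

HB.instance Definition _ := isGroup.Build heis
  heis_mulA heis_mul1 heis_1mul heis_mulV heis_Vmul.

Lemma heis_mulE x y : x * y = heis_mul x y. Proof. by []. Qed.
Lemma heis_invE x : x^-1 = heis_inv x. Proof. by []. Qed.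

Lemma heis_conjE x y :
  y ^ x = (y.1.1, y.1.2, y.2 + y.1.1 * x.1.2 - x.1.1 * y.1.2)%R.
Proof.
rewrite conjgE !heis_mulE heis_invE; case: x y => [[a b] c] [[a' b'] c'].
by rewrite /heis_mul /heis_inv /=; congr (_, _, _); ring.
Qed.

End Heisenberg.

Section Independence.
Variable G : sgraph.
Implicit Types (m n u v w : G) (f : lit G -> int) (d : raag G -> int).

Definition additive_on d := forall x y, d (x * y) = (d x + d y)%R.

Section Additive.
Variables (d : raag G -> int).
Hypothesis dM : additive_on d.

Lemma additive1 : d 1 = 0%R.
Proof. by apply: (addrI (d 1)); rewrite -dM mulg1 addr0. Qed.

Lemma additiveV x : d x^-1 = (- d x)%R.
Proof. by apply: (addrI (d x)); rewrite -dM mulgV additive1 addrN. Qed.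

Lemma additiveJ x y : d (x ^ y) = d x.
Proof. by rewrite conjgE !dM additiveV; ring. Qed.

Lemma additive_zpow x z : d (zpow x z) = (z * d x)%R.
Proof.
elim/int_rect: z => [|n IH|n IH]; first by rewrite additive1 mul0r.
  by rewrite intS zpowD dM IH zpow1; ring.
by rewrite intS opprD zpowD dM IH zpowN additiveV zpow1; ring.
Qed.

End Additive.

Lemma additive_ext d d' : additive_on d -> additive_on d' ->
  (forall v, d (gen v) = d' (gen v)) -> d =1 d'.
Proof.
move=> dM d'M dd'; elim/raag_ind => [|v x IH|v x IH].
- by rewrite !additive1.
- by rewrite dM d'M IH dd'.
- by rewrite dM d'M IH !additiveV // dd'.
Qed.

Lemma additive_twist_gen d n f v : additive_on d -> admissible n f ->
  d (twist_aut n f (gen v)) =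
  (d (gen v) + (if v \in st n then 0 else
                  (f (v, false) - f (v, true)) * d (gen n)))%R.
Proof.
move=> dM fa; rewrite twist_autE // twist_genE // /twist_gen.
case: ifP => _; first by rewrite addr0.
by rewrite !dM !additive_zpow //; ring.
Qed.

Lemma additive_twist d n f : additive_on d -> admissible n f ->
  (forall v, v \notin st n -> (f (v, false) - f (v, true)) * d (gen n) = 0)%R ->
  forall x, d (twist_aut n f x) = d x.
Proof.
move=> dM fa df; apply: additive_ext => [x y|//|v]; first by rewrite autM dM.
rewrite additive_twist_gen //; case: ifPn => vn; first by rewrite addr0.
by rewrite df // addr0.
Qed.

Lemma aut_mulE (g h : Defs.aut (raag G)) x : (g * h) x = g (h x).
Proof. by []. Qed.

(** The hypothesis says that the defect y |-> d (psi n y) - d y of each factor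
    is invariant under all factors, so the defects add up along the product. *)
Lemma sum_of_defects (s : seq G) (psi : G -> Defs.aut (raag G)) d x :
  (forall n n' y, n \in s -> n' \in s ->
     d (psi n (psi n' y)) - d (psi n' y) = d (psi n y) - d y)%R ->
  (d ((\prod_(n <- s) psi n)%g x) = d x + \sum_(n <- s) (d (psi n x) - d x))%R.
Proof.
move=> dpsi.
have inv n t y : n \in s -> {subset t <= s} ->
    (d (psi n ((\prod_(n' <- t) psi n')%g y)) - d ((\prod_(n' <- t) psi n')%g y)
     = d (psi n y) - d y)%R.
  move=> ns; elim: t y => [|n' t IH] y ts; first by rewrite big_nil.
  rewrite big_cons aut_mulE dpsi //; last by apply: ts; rewrite mem_head.
  by apply: IH => z zt; apply: ts; rewrite inE zt orbT.
suff sum_sub : forall t, {subset t <= s} ->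
    (d ((\prod_(n <- t) psi n)%g x) =
      d x + \sum_(n <- t) (d (psi n x) - d x))%R.
  exact: sum_sub.
elim=> [|n t IH] ts; first by rewrite !big_nil addr0.
have ts' : {subset t <= s} by move=> z zt; apply: ts; rewrite inE zt orbT.
rewrite !big_cons aut_mulE -(inv n t) //; last by apply: ts; rewrite mem_head.
rewrite [RHS]addrCA -(IH ts').
by rewrite subrK.
Qed.

Section HeisenbergQuotient.
Variables m u : G.
Hypothesis mu : ~~ adj m u.

Definition heis_gen v : heis := ((v == m)%:Z, (v == u)%:Z, 0)%R.
(** The last coordinate counts with signs the occurrences of m before u in a
    word; it is well defined because m and u are not adjacent. *)
Definition heis_map : raag G -> heis := raag_lift heis_gen.

Lemma heis_gen_comm v w : adj v w -> commute (heis_gen v) (heis_gen w).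
Proof.
move=> vw; rewrite /commute !heis_mulE /heis_mul /=.
congr (_, _, _); [exact: addrC|exact: addrC|].
have: ~~ ((v == m) && (w == u)) && ~~ ((w == m) && (v == u)).
  apply/andP; split; apply: contra mu => /andP[/eqP<- /eqP<-] //.
  by rewrite adj_sym.
by do 4!case: eqP.
Qed.

Lemma heis_mapM : {morph heis_map : x y / x * y}.
Proof. exact/raag_liftM/heis_gen_comm. Qed.

Lemma heis_map_gen v : heis_map (gen v) = heis_gen v.
Proof. exact/raag_lift_gen/heis_gen_comm. Qed.

Lemma heis_additive1 : additive_on (fun x => (heis_map x).1.1).
Proof. by move=> x y; rewrite heis_mapM. Qed.

Lemma heis_additive2 : additive_on (fun x => (heis_map x).1.2).
Proof. by move=> x y; rewrite heis_mapM. Qed.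

Lemma heis_map3M x y : (heis_map (x * y)).2 =
  ((heis_map x).2 + (heis_map y).2 + (heis_map x).1.1 * (heis_map y).1.2)%R.
Proof. by rewrite heis_mapM. Qed.

Lemma heis_map3J x y : (heis_map (x ^ y)).2 = ((heis_map x).2 +
  (heis_map x).1.1 * (heis_map y).1.2 - (heis_map y).1.1 * (heis_map x).1.2)%R.
Proof. by rewrite (morph_conj heis_mapM) heis_conjE. Qed.

End HeisenbergQuotient.

Definition exponent_sum m x : int := (heis_map m m x).1.1.

Lemma exponent_sumM m : additive_on (exponent_sum m).
Proof. by apply: heis_additive1; rewrite adj_irrefl. Qed.

Lemma exponent_sum_gen m v : exponent_sum m (gen v) = ((v == m)%:Z)%R.
Proof. by rewrite /exponent_sum heis_map_gen // adj_irrefl. Qed.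

Lemma heis_map1E m u x : ~~ adj m u -> (heis_map m u x).1.1 = exponent_sum m x.
Proof.
move=> mu; move: x; apply: additive_ext.
- exact: heis_additive1.
- exact: exponent_sumM.
- by move=> v; rewrite exponent_sum_gen heis_map_gen.
Qed.

Lemma heis_map2E m u x : ~~ adj m u -> (heis_map m u x).1.2 = exponent_sum u x.
Proof.
move=> mu; move: x; apply: additive_ext.
- exact: heis_additive2.
- exact: exponent_sumM.
- by move=> v; rewrite exponent_sum_gen heis_map_gen.
Qed.

Section ProductOfTwists.
Variables (s : seq G) (F : G -> lit G -> int).
Hypothesis s_uniq : uniq s.
Hypothesis F_adm : forall m, m \in s -> admissible m (F m).
Hypothesis F_base : forall m n, m \in s -> n \in s -> n \notin st m ->
  F m (n, true) = F m (n, false).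
Hypothesis F_inner : inner (\prod_(m <- s) twist_aut m (F m)).

(** The exponent sum of m in the image of u is changed only by the twist with
    base m, and only by F m (u^-1) - F m u. The other bases are fixed up to
    conjugation by every factor, so nothing else interferes. *)
Lemma twist_product_symmetric m u : m \in s -> u \notin st m ->
  F m (u, true) = F m (u, false).
Proof.
move=> ms um; case: F_inner => g /(_ (gen u)) Fu.
have um' : (u == m) = false by apply: contraNF um => /eqP->; rewrite in_st eqxx.
have := congr1 (exponent_sum m) Fu; rewrite additiveJ;
  last exact: exponent_sumM.
rewrite sum_of_defects => [|n n' y ns n's]; last first.
  pose D x := (exponent_sum m (twist_aut n (F n) x) - exponent_sum m x)%R.
  rewrite -/(D _) -/(D y); apply: additive_twist (F_adm n's) _ _.
    by move=> x z; rewrite /D autM !exponent_sumM; ring.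
  move=> v _; rewrite /D additive_twist_gen;
    [|exact: exponent_sumM|exact: F_adm].
  case: ifPn => [_|n'n]; first by ring.
  by rewrite (F_base ns n's n'n); ring.
have symm n : n \in s -> (exponent_sum m (twist_aut n (F n) (gen u)) -
    exponent_sum m (gen u) = if n != m then 0 else F m (u, false) - F m (u, true))%R.
  move=> ns; rewrite additive_twist_gen ?exponent_sum_gen //;
    [|exact: exponent_sumM|exact: F_adm].
  rewrite um' add0r subr0; case: (eqVneq n m) => [->|nm].
    by rewrite (negPf um) mulr1.
  by rewrite mulr0 if_same.
rewrite (bigD1_seq m) //= big1_seq => [|n /andP[nm ns]];
  last by rewrite symm // nm.
rewrite symm // eqxx addr0 exponent_sum_gen um' add0r => /eqP.
by rewrite subr_eq0 => /eqP.
Qed.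

(** By the previous lemma all factors conjugate each generator, so they
    preserve exponent sums and their defects on the corner of the Heisenberg
    quotient of (m, u) add up. On u only the factor with base m has a defect, -
    F m u, while conjugation by g changes the corner by minus the exponent sum
    of m in g, a number that does not depend on u. *)
Lemma twist_product_constant m : m \in s ->
  exists c : int, forall l, l.1 \notin st m -> F m l = c.
Proof.
move=> ms; case: (F_inner) => g Fg; exists (exponent_sum m g) => -[u b] /= um.
suff {b} <- : F m (u, true) = exponent_sum m g.
  by case: b => //; rewrite twist_product_symmetric.
have um' : (u == m) = false by apply: contraNF um => /eqP->; rewrite in_st eqxx.
have mu : ~~ adj m u by apply: contra um; rewrite in_st orbC => ->.
have symm n : n \in s -> forall d, additive_on d ->
  forall x, d (twist_aut n (F n) x) = d x.
  move=> ns d dM; apply: additive_twist (F_adm ns) _ => // v vn.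
  by rewrite -(twist_product_symmetric ns vn) subrr mul0r.
pose c x := (heis_map m u x).2.
pose D n x := (c (twist_aut n (F n) x) - c x)%R.
have DM n : n \in s -> additive_on (D n).
  move=> ns x y; rewrite /D /c autM !heis_map3M //.
  by rewrite !heis_map1E ?heis_map2E // !symm //; try exact: exponent_sumM;
    ring.
have Du n : n \in s -> D n (gen u) =
  if n == m then (- F m (u, true))%R else 0%R.
  move=> ns; rewrite /D /c twist_autE; last exact: F_adm.
  rewrite twist_genE; last exact: F_adm.
  rewrite /twist_gen; have [->|nm] := eqVneq n m.
    rewrite (negPf um) -twist_product_symmetric // zpowN -mulgA -conjgE.
    rewrite heis_map3J // heis_map_gen //= um' eqxx.
    rewrite (heis_map1E _ mu) additive_zpow ?exponent_sum_gen ?eqxx; last first.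
      exact: exponent_sumM.
    by rewrite mul0r !mulr1 addr0 sub0r.
  case: ifPn => [_|un]; first by rewrite subrr.
  have hn : heis_map m u (gen n) = 1.
    rewrite heis_map_gen // /heis_gen (negPf nm).
    suff /negPf-> : n != u by [].
    by apply: contraNneq un => ->; rewrite in_st eqxx.
  rewrite !(heis_mapM mu) !(morph_zpow (heis_mapM mu)) hn.
  have one_zpow z : zpow (1 : heis) z = 1 by case: z => k /=;
    rewrite ?expg1n ?invg1.
  by rewrite !one_zpow mulg1 mul1g subrr.
have := congr1 c (Fg (gen u)).
rewrite sum_of_defects => [|n n' y ns n's]; last first.
  by rewrite -/(D n _) -/(D n y); apply: symm => //; apply: DM.
rewrite (bigD1_seq m) //= big1_seq => [|n /andP[nm ns]]; last first.
  by rewrite -/(D n _) Du // (negPf nm).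
rewrite -/(D m _) Du // eqxx /c heis_map3J //.
rewrite heis_map_gen // (heis_map1E _ mu) /= um' eqxx; lia.
Qed.

End ProductOfTwists.
End Independence.

(** * Twists modulo inner automorphisms *)

Section OuterTwists.
Variable G : sgraph.
Implicit Types (m n u v w : G) (f g : lit G -> int).
Local Notation Aut := (Defs.aut (raag G)).
Local Notation Out := (out (raag G)).

Lemma out_piM (a b : Aut) : \pi_Out a * \pi_Out b = \pi_Out (a * b).
Proof. exact: out_mulE. Qed.

Lemma out_pi_prod (s : seq G) (psi : G -> Aut) :
  \prod_(m <- s) \pi_Out (psi m) = \pi_Out (\prod_(m <- s) psi m).
Proof. by elim: s => [|m s IH]; rewrite ?big_nil // !big_cons IH out_piM. Qed.

Lemma out_pi_eq1 (a : Aut) : \pi_Out a = 1 -> inner a.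
Proof. by move=> /esym/out_piE; rewrite invg1 mul1g. Qed.

Lemma inner_out_pi (a : Aut) : inner a -> \pi_Out a = 1.
Proof. by move=> ina; symmetry; apply/out_piE; rewrite invg1 mul1g. Qed.

Definition outer_twist m f : Out := \pi_Out (twist_aut m f).

Lemma eq_outer_twist m f g : admissible m f -> admissible m g ->
  (forall l, l.1 \notin st m -> f l = g l) -> outer_twist m f = outer_twist m g.
Proof.
move=> fa ga fg; congr (\pi_Out _); apply: Defs.autE => x.
by rewrite !twist_autE //; apply: eq_twist.
Qed.

Lemma outer_twistD m f g : admissible m f -> admissible m g ->
  outer_twist m (fun l => f l + g l)%R = outer_twist m f * outer_twist m g.
Proof.
move=> fa ga; rewrite /outer_twist out_piM; congr (\pi_Out _);
  apply: Defs.autE => x.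
rewrite twist_autE; last exact: admissibleD.
by rewrite aut_mulE !twist_autE // -(twistD fa ga).
Qed.

Lemma outer_twist_cst m (c : int) : outer_twist m (fun=> c) = 1.
Proof.
apply: inner_out_pi; exists (zpow (gen m) c) => x.
by rewrite twist_autE ?twist_cst //; apply: admissible_cst.
Qed.

Lemma outer_twist0 m f : admissible m f -> (forall l, l.1 \notin st m ->
  f l = 0%R) ->
  outer_twist m f = 1.
Proof. by move=> fa f0; rewrite -(outer_twist_cst m 0);
  apply: eq_outer_twist. Qed.

Lemma outer_twistN m f : admissible m f ->
  outer_twist m (fun l => - f l)%R = (outer_twist m f)^-1.
Proof.
move=> fa; have fN := admissibleN fa; apply: (mulIg (outer_twist m f)).
rewrite mulVg -outer_twistD //; apply: outer_twist0 => [|l _];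
  first exact: admissibleD.
by rewrite addNr.
Qed.

Lemma outer_twist_shift m f c : admissible m f ->
  outer_twist m (fun l => f l + c)%R = outer_twist m f.
Proof.
move=> fa; have ca : admissible m (fun=> c) by exact: admissible_cst.
by rewrite (outer_twistD fa ca) outer_twist_cst mulg1.
Qed.

Lemma twist_aut_commute m n f g : admissible m f -> admissible n g ->
  twist_aut m f (gen n) = gen n -> twist_aut n g (gen m) = gen m ->
  (forall l, l.1 \notin st m -> l.1 \notin st n ->
     commute (zpow (gen m) (f l)) (zpow (gen n) (g l))) ->
  commute (twist_aut m f) (twist_aut n g).
Proof.
move=> fa ga fn gm fg; apply: Defs.autE; apply: raag_hom_ext.
- by move=> x y; rewrite !autM.
- by move=> x y; rewrite !autM.
have fz z : twist m f (zpow (gen n) z) = zpow (gen n) z.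
  by rewrite (morph_zpow (twistM fa)) -twist_autE // fn.
have gz z : twist n g (zpow (gen m) z) = zpow (gen m) z.
  by rewrite (morph_zpow (twistM ga)) -twist_autE // gm.
move=> v; rewrite !aut_mulE !twist_autE // (twist_genE v fa) (twist_genE v ga).
rewrite /twist_gen; case: ifPn => vn; case: ifPn => vm.
- by rewrite !twist_fix.
- rewrite !(twistM ga) !gz (twist_fix ga vn) (twist_genE v fa) /twist_gen.
  by rewrite (negPf vm).
- rewrite !(twistM fa) !fz (twist_fix fa vm) (twist_genE v ga) /twist_gen.
  by rewrite (negPf vn).
rewrite !(twistM ga) !(twistM fa) !fz !gz !twist_genE // /twist_gen.
rewrite (negPf vn) (negPf vm) !zpowN !mulgA.
have /commuteV/commute_sym/commuteV := fg (v, true) vm vn.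
have := fg (v, false) vm vn; rewrite /commute => e1 e2.
by rewrite -!mulgA e1 !mulgA e2.
Qed.

Lemma outer_twist_commute_adj m n f g : admissible m f -> admissible n g ->
  adj m n -> commute (outer_twist m f) (outer_twist n g).
Proof.
move=> fa ga mn; rewrite /commute /outer_twist !out_piM; congr (\pi_Out _).
apply: twist_aut_commute => //.
- by rewrite twist_autE // twist_fix // in_st mn orbT.
- by rewrite twist_autE // twist_fix // in_st adj_sym mn orbT.
move=> l _ _; apply/commute_zpow/commute_sym/commute_zpow.
by apply/commute_sym/commute_gen.
Qed.

(** Subtracting the constants f (n, true) and g (m, true) does not change the
    outer classes; the shifted twists fix the base of each other, and no
    literal is multiplied by both. *)
Lemma outer_twist_commute_far m n f g : admissible m f -> admissible n g ->
  f (n, true) = f (n, false) -> g (m, true) = g (m, false) ->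
  (forall l, l.1 \notin st m -> l.1 \notin st n ->
     (f l - f (n, true)) * (g l - g (m, true)) = 0)%R ->
  commute (outer_twist m f) (outer_twist n g).
Proof.
move=> fa ga fn gm fg.
have fa' : admissible m (fun l => f l - f (n, true))%R by apply: admissibleD.
have ga' : admissible n (fun l => g l - g (m, true))%R by apply: admissibleD.
rewrite /commute -(outer_twist_shift (- f (n, true))%R fa).
rewrite -(outer_twist_shift (- g (m, true))%R ga) /outer_twist !out_piM;
  congr (\pi_Out _).
have fix_base a b (h : lit G -> int) : admissible a h ->
    h (b, true) = 0%R -> h (b, false) = 0%R -> twist_aut a h (gen b) = gen b.
  move=> ha h1 h2; rewrite twist_autE // twist_genE // /twist_gen h1 h2.
  by rewrite oppr0 zpow0 mul1g mulg1 if_same.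
apply: twist_aut_commute => //.
- by apply: fix_base => //; rewrite ?fn subrr.
- by apply: fix_base => //; rewrite ?gm subrr.
move=> l lm ln; have /eqP := fg l lm ln.
rewrite mulf_eq0 => /orP[] /eqP ->; first by rewrite zpow0;
  apply/commute_sym/commute1.
by rewrite zpow0; apply: commute1.
Qed.

End OuterTwists.

(** * Twists in the untwisted subgroup *)

Section Membership.
Variable G : sgraph.
Implicit Types (m v w : G) (S T : {set lit G}).
Local Notation Out := (out (raag G)).

Definition indicator S (l : lit G) : int := ((l \in S)%:Z)%R.

(** S is a union of sets that are inseparable for m, as far as literals off the
    star of m are concerned. *)
Definition inseparable_union m S := forall v w b c,
  v \notin st m -> w \notin st m -> adj v w -> ((v, b) \in S) = ((w, c) \in S).

Lemma admissible_indicator m S : inseparable_union m S ->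
  admissible m (indicator S).
Proof. by move=> Sm v w b c vm wm vw; rewrite /indicator (Sm v w b c). Qed.

Variable H : set Out.
Hypothesis H_group : is_subgroup H.
Hypothesis H_gen : classical_sets.subset
  [set \pi_Out phi | phi in @untwisted_gen G]%classic H.

Lemma subgroup1 : H 1.
Proof. by case: H_group => /set_mem. Qed.

Lemma subgroupM a b : H a -> H b -> H (a * b).
Proof.
move=> Ha Hb; apply/set_mem/(group_closedM H_group); exact: mem_set.
Qed.

Lemma subgroupV a : H a -> H a^-1.
Proof. by move=> Ha; apply/set_mem/(group_closedV H_group); exact: mem_set. Qed.

Lemma untwisted_gen_outer_twist m f : untwisted_gen (twist_aut m f) ->
  H (outer_twist m f).
Proof. by move=> phi; apply: H_gen; exists (twist_aut m f). Qed.

(** If the link of v is contained in that of m, then v is isolated off the link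
    of m, and multiplying one end of v by m is a fold or the inverse of one. *)
Lemma outer_twist_fold m v b : v \notin st m -> lk v \subset lk m ->
  inseparable_union m [set (v, b)] /\ H (outer_twist m (indicator [set (v, b)])).
Proof.
move=> vm /subsetP sub_lk.
have iu : inseparable_union m [set (v, b)].
  have no u w c : w \notin st m -> adj u w -> ((u, c) \in [set (v, b)]) = false.
    move=> wm uw; apply: contraNF wm; rewrite inE => /eqP[uv _].
    by have := sub_lk w; rewrite !in_lk in_st -uv uw => -> //; rewrite orbT.
  move=> u w c c' um wm uw; have wu : adj w u by rewrite adj_sym.
  by rewrite (no u w) // (no w u).
split=> //; have indv := admissible_indicator iu.
have vNm : v != m by apply: contraNneq vm => ->; rewrite in_st eqxx.
have fixw w c : w != v -> (indicator [set (v, b)] (w, c) = 0)%R.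
  by move=> wv; rewrite /indicator inE xpair_eqE (negPf wv).
have fix_gen f w : admissible m f -> f (w, true) = 0%R -> f (w, false) = 0%R ->
    twist_aut m f (gen w) = gen w.
  move=> fa f1 f2; rewrite twist_autE // twist_genE // /twist_gen f1 f2.
  by rewrite oppr0 zpow0 mul1g mulg1 if_same.
case: b iu indv fixw => iu indv fixw.
  have indN := admissibleN indv.
  rewrite -[outer_twist _ _]invgK -outer_twistN //;
    apply/subgroupV/untwisted_gen_outer_twist.
  apply: Or43; right; exists v, m; split=> //; first exact/subsetP.
    rewrite twist_autE // twist_genE // /twist_gen (negPf vm) /indicator !inE !xpair_eqE !eqxx.
    by rewrite opprK oppr0 zpow0 zpow1 mulg1.
  by move=> w wv; apply: fix_gen; rewrite ?fixw ?oppr0.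
apply/untwisted_gen_outer_twist/Or43; left; exists v, m; split=> //;
  first exact/subsetP.
  rewrite twist_autE // twist_genE // /twist_gen (negPf vm) /indicator !inE !xpair_eqE !eqxx.
  by rewrite oppr0 zpow0 zpow1 mul1g.
by move=> w wv; apply: fix_gen; rewrite ?fixw.
Qed.

Definition off_star m : rel G :=
  [rel x y | [&& adj x y, x \notin st m & y \notin st m]].

Definition off_star_component m v :
  {set G} := [set w | connect (off_star m) v w].

Lemma in_component m v w :
  (w \in off_star_component m v) = connect (off_star m) v w.
Proof. by rewrite inE. Qed.

Lemma off_star_connect_sym m : connect_sym (off_star m).
Proof.
apply: sym_connect_sym => x y; rewrite /off_star /=.
by rewrite adj_sym (andbC (x \notin _)).
Qed.

Lemma off_star_component_notin m v w : v \notin st m ->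
  w \in off_star_component m v -> w \notin st m.
Proof.
rewrite in_component => vm /connectP[p]; elim: p v vm => [|u p IH] v vm /=.
  by move=> _ ->.
by case/andP=> /and3P[_ _ um] pth; apply: IH.
Qed.

Lemma outer_twist_partial_conj m v : v \notin st m ->
  inseparable_union m (pm (off_star_component m v)) /\
  H (outer_twist m (indicator (pm (off_star_component m v)))).
Proof.
move=> vm; set C := off_star_component m v.
have iu : inseparable_union m (pm C).
  move=> u w c c' um wm uw; rewrite !inE /=.
  have uw' : connect (off_star m) u w by apply: connect1;
    rewrite /off_star /= uw um wm.
  by apply: (same_connect_r (off_star_connect_sym m)).
split=> //; have indC := admissible_indicator iu.
apply/untwisted_gen_outer_twist/Or44; exists m, C; split.
- by apply/existsP; exists v; rewrite vm; apply/eqP/setP=> w; rewrite !inE.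
- move=> u uC; have um := off_star_component_notin vm uC.
  rewrite twist_autE // twist_genE // /twist_gen (negPf um) /indicator !inE /=.
  by move: uC; rewrite inE => ->; rewrite zpowN zpow1.
- move=> u uC; rewrite twist_autE // twist_genE // /twist_gen /indicator !inE /=.
  by move: uC; rewrite inE => /negPf->; rewrite oppr0 zpow0 mul1g mulg1 if_same.
Qed.

(** S is exhausted by single literals, which give folds, and by full
    components, which give partial conjugations. *)
Lemma outer_twist_indicator m S : inseparable_union m S ->
  (forall l, l \in S -> l.1 \notin st m) ->
  H (outer_twist m (indicator S)).
Proof.
have [k] := ubnP #|S|; elim: k S => // k IH S leSk Sm S_off.
have [S0|/set0Pn[[v b] vS]] := eqVneq S finset.set0.
  rewrite outer_twist0; [exact: subgroup1|exact: admissible_indicator|].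
  by move=> l _; rewrite /indicator S0 inE.
have vm : v \notin st m := S_off _ vS.
suff [T [Tv TS Tm HT]] : exists T, [/\ (v, b) \in T, T \subset S, inseparable_union m T
    & H (outer_twist m (indicator T))].
  have STm : inseparable_union m (S :\: T).
    by move=> u w c c' um wm uw; rewrite !inE (Tm u w c c') // (Sm u w c c').
  have -> : outer_twist m (indicator S) =
    outer_twist m (indicator T) * outer_twist m (indicator (S :\: T)).
    rewrite -outer_twistD; [|exact: admissible_indicator|exact: admissible_indicator].
    apply: eq_outer_twist; first exact: admissible_indicator.
      by apply: admissibleD; exact: admissible_indicator.
    move=> l _; rewrite /indicator inE; have := subsetP TS l.
    by case: (l \in T) => [->|_]; case: (l \in S).
  apply: subgroupM => //; apply: IH => //.
    rewrite ltnS in leSk; apply: leq_trans leSk; apply: proper_card.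
    by apply/properP; split; [exact: subsetDl | exists (v, b);
      rewrite // inE Tv].
  by move=> l; rewrite inE => /andP[_]; apply: S_off.
have [lkv|/subsetPn[w]] := boolP (lk v \subset lk m).
  have [iu HT] := outer_twist_fold b vm lkv; exists [set (v, b)].
  by split; rewrite ?inE ?sub1set.
rewrite !in_lk => vw wm.
have wst : w \notin st m.
  rewrite in_st negb_or wm andbT; apply: contraNneq vm => <-.
  by rewrite in_st adj_sym vw orbT.
have [iu HT] := outer_twist_partial_conj vm;
  exists (pm (off_star_component m v)).
split=> //; first by rewrite inE in_component connect0.
have vS' c : (v, c) \in S by rewrite (Sm v w c true) // -(Sm v w b true).
apply/subsetP=> -[u c]; rewrite inE in_component /= => /connectP[p pth ->].
elim: p v pth vS' {vS vm vw iu HT} => [|x p IHp] v //= /andP[/and3P[vx vm xm] pth] vS.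
by apply: IHp => // c'; rewrite -(Sm v x c c').
Qed.

Lemma outer_twist_scale m f z : admissible m f -> H (outer_twist m f) ->
  admissible m (fun l => z * f l)%R /\ H (outer_twist m (fun l => z * f l)%R).
Proof.
move=> fa Hf.
have adm y : admissible m (fun l => y * f l)%R.
  by move=> v w b c vm wm vw; rewrite (fa v w b c).
split=> //; elim/int_rect: z => [|n IH|n IH].
- rewrite outer_twist0; [exact: subgroup1|exact: adm|].
  by move=> l _; rewrite mul0r.
- rewrite (_ : outer_twist m _ =
  outer_twist m f * outer_twist m (fun l => n%:Z * f l)%R).
    exact: subgroupM.
  rewrite -outer_twistD //; apply: eq_outer_twist => //;
    first exact: admissibleD.
  by move=> l _; rewrite intS mulrDl mul1r.
- rewrite (_ : outer_twist m _ =
  (outer_twist m f)^-1 * outer_twist m (fun l => - n%:Z * f l)%R).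
    by apply: subgroupM => //; apply: subgroupV.
  rewrite -outer_twistN // -outer_twistD //; last exact: admissibleN.
  apply: eq_outer_twist => //; first by apply: admissibleD => //;
    exact: admissibleN.
  by move=> l _; rewrite intS opprD mulrDl mulN1r.
Qed.

End Membership.

(** * Families of commuting twists *)

Section TwistFamily.
(** The i-th twist has base b i and multiplies the ends in S i. [S_base] and
    [S_far] make the twists commute up to inner automorphisms, [S_disj] and
    [S_cover] make them independent. *)
Variables (G : sgraph) (r : nat) (b : 'I_r -> G) (S : 'I_r -> {set lit G}).
Local Notation Out := (out (raag G)).

Hypothesis S_off : forall i l, l \in S i -> l.1 \notin st (b i).
Hypothesis S_neq0 : forall i, exists l, l \in S i.
Hypothesis S_union : forall i, inseparable_union (b i) (S i).
Hypothesis S_base : forall i j, b j \notin st (b i) ->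
  ((b j, true) \in S i) = ((b j, false) \in S i).
Hypothesis S_far : forall i j, b j \notin st (b i) ->
  forall l, l.1 \notin st (b i) -> l.1 \notin st (b j) ->
  (l \in S i) = ((b j, true) \in S i) \/ (l \in S j) = ((b i, true) \in S j).
Hypothesis S_disj : forall i j, b i = b j -> i != j -> [disjoint S i & S j].
Hypothesis S_cover : forall i, exists l, l.1 \notin st (b i) /\
  forall j, b j = b i -> l \notin S j.

Let bases := undup (codom b).

Lemma mem_bases m : m \in bases -> exists i, m = b i.
Proof. by rewrite mem_undup => /codomP. Qed.

Lemma base_mem i : b i \in bases.
Proof. by rewrite mem_undup codom_f. Qed.

Definition weight (x : 'rV[int]_r) m (l : lit G) : int :=
  (\sum_(i | b i == m) x ord0 i * indicator (S i) l)%R.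

Lemma weight_adm x m : admissible m (weight x m).
Proof.
move=> v w c c' vm wm vw; apply: eq_bigr => i /eqP bi; congr (_ * _)%R.
  by apply: (admissible_indicator (@S_union i)); rewrite ?bi.
Qed.

Lemma weightD x y m l : weight (x + y)%R m l = (weight x m l + weight y m l)%R.
Proof. by rewrite -big_split; apply: eq_bigr => i _; rewrite mxE mulrDl. Qed.

Lemma weight_base x i j : b j \notin st (b i) ->
  weight x (b i) (b j, true) = weight x (b i) (b j, false).
Proof.
move=> ji; apply: eq_bigr => k /eqP bk; congr (_ * _)%R.
by rewrite /indicator S_base // bk.
Qed.

Lemma weight_sub x m l l' :
  (weight x m l - weight x m l')%R =
  (\sum_(i | b i == m) x ord0 i * (indicator (S i) l - indicator (S i) l'))%R.
Proof. by rewrite -sumrB; apply: eq_bigr => i _; rewrite mulrBr. Qed.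

(** By bilinearity the commutation criterion passes from the sets S i and S j
    to integral combinations of their indicator functions. *)
Lemma weight_far x y i j l : b j \notin st (b i) ->
  l.1 \notin st (b i) -> l.1 \notin st (b j) ->
  ((weight x (b i) l - weight x (b i) (b j, true)) *
   (weight y (b j) l - weight y (b j) (b i, true)) = 0)%R.
Proof.
move=> ji li lj; rewrite !weight_sub big_distrl big1 //= => i' /eqP bi'.
rewrite big_distrr big1 //= => j' /eqP bj'.
have ij' : b j' \notin st (b i') by rewrite bi' bj'.
have := S_far ij' (l := l); rewrite bi' bj' => /(_ li lj).
by rewrite /indicator => -[->|->]; rewrite subrr mulr0 ?mul0r ?mulr0.
Qed.

Lemma weight_inside x i l : l \in S i -> weight x (b i) l = x ord0 i.
Proof.
move=> lS; rewrite /weight (bigD1 i) //= big1 => [|j /andP[/eqP bij ji]].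
  by rewrite /indicator lS mulr1 addr0.
by rewrite /indicator (disjointFl (S_disj bij ji) lS) mulr0.
Qed.

Lemma weight_outside x i l :
  (forall j, b j = b i -> l \notin S j) -> weight x (b i) l = 0%R.
Proof.
by move=> lS; apply: big1 => j /eqP/lS/negPf; rewrite /indicator => ->;
  rewrite mulr0.
Qed.

(** The twists with the same base are first combined into one, so that
    [twist_product_constant] applies. *)
Definition family_map (x : 'rV[int]_r) : Out :=
  \prod_(m <- bases) outer_twist m (weight x m).

Lemma outer_twist_weight_commute x y m n : m \in bases -> n \in bases ->
  commute (outer_twist m (weight x m)) (outer_twist n (weight y n)).
Proof.
move=> /mem_bases[i ->] /mem_bases[j ->].
have [ji|] := boolP (b j \in st (b i)); last first.
  move=> ji; have ij : b i \notin st (b j).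
    by move: ji; rewrite !in_st eq_sym adj_sym.
  apply: outer_twist_commute_far; try exact: weight_adm; try exact: weight_base.
  by move=> l li lj; apply: weight_far.
move: ji; rewrite in_st => /orP[/eqP->|ij].
  rewrite /commute -!outer_twistD; try exact: weight_adm.
  by apply: eq_outer_twist => [||l _]; [| |exact: addrC]; apply: admissibleD;
    exact: weight_adm.
by apply: outer_twist_commute_adj => //; exact: weight_adm.
Qed.

Lemma family_mapD : {morph family_map : x y / (x + y)%R >-> x * y}.
Proof.
move=> x y; rewrite /family_map.
rewrite big_seq [X in _ = X * _]big_seq [X in _ = _ * X]big_seq.
rewrite -prodgM_commute => [|m n ms ns]; last exact: outer_twist_weight_commute.
apply: eq_bigr => m _; rewrite -outer_twistD; try exact: weight_adm.
apply: eq_outer_twist => [||l _]; last exact: weightD.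
  exact: weight_adm.
by apply: admissibleD; exact: weight_adm.
Qed.

(** The combined function at b i is constant off the star; the constant is 0 at
    a literal outside all S j with the same base, and x i on S i. *)
Lemma family_map_ker x : family_map x = 1 -> x = 0%R.
Proof.
rewrite /family_map out_pi_prod => /out_pi_eq1 Finn.
apply/rowP=> i; rewrite mxE.
have [c Fc] : exists c : int, forall l, l.1 \notin st (b i) ->
  weight x (b i) l = c.
  apply: (twist_product_constant (undup_uniq _) _ _ Finn (base_mem i)).
    by move=> m _; exact: weight_adm.
  by move=> m n /mem_bases[i' ->] /mem_bases[j ->]; exact: weight_base.
have [l lS] := S_neq0 i; have [l' [l'i l'S]] := S_cover i.
by rewrite -(weight_inside x lS) Fc ?S_off // -(Fc l' l'i) weight_outside.
Qed.

Lemma family_map_inj : injective family_map.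
Proof.
move=> x y exy; apply/eqP; rewrite -subr_eq0; apply/eqP/family_map_ker.
by apply: (mulIg (family_map y)); rewrite -family_mapD subrK mul1g.
Qed.

Lemma family_map_untwisted x : untwisted G (family_map x).
Proof.
move=> H [H_group H_gen]; rewrite /family_map.
apply: (big_ind H) => [||m _]; first exact: subgroup1.
  by move=> g h; apply: subgroupM.
rewrite /weight.
suff sum_in : forall t : seq 'I_r,
    let f l := (\sum_(i <- t | b i == m) x ord0 i * indicator (S i) l)%R in
    admissible m f /\ H (outer_twist m f).
  by have [] := sum_in (index_enum 'I_r).
elim=> [|i t [ft Ht]] f.
  have f0 l : f l = 0%R by rewrite /f big_nil.
  have fa : admissible m f by move=> *; rewrite !f0.
  by split=> //; rewrite outer_twist0 //; exact: subgroup1.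
have [bi|bi] := boolP (b i == m); last first.
  suff -> : f = (fun l => \sum_(i <- t | b i == m) x ord0 i * indicator (S i) l)%R by [].
  by apply/funext=> l; rewrite /f big_cons (negPf bi).
have -> : f = (fun l => x ord0 i * indicator (S i) l +
    \sum_(i <- t | b i == m) x ord0 i * indicator (S i) l)%R.
  by apply/funext=> l; rewrite /f big_cons bi.
have iu : inseparable_union m (S i) by rewrite -(eqP bi); exact: S_union.
have [|fi Hi] := outer_twist_scale H_group (x ord0 i) (admissible_indicator iu).
  by apply: outer_twist_indicator => // l; rewrite -(eqP bi); exact: S_off.
split; first exact: admissibleD.
by rewrite outer_twistD //; exact: subgroupM.
Qed.

Lemma twist_family_free_abelian : exists H : set Out,
  classical_sets.subset H (untwisted G) /\ free_abelian_subgroup r H.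
Proof.
exists (range family_map); split.
  by move=> _ [x _ <-]; exact: family_map_untwisted.
split; last by exists family_map; split;
  [exact: family_mapD|exact: family_map_inj|].
have map0 : family_map 0%R = 1.
  by apply: (mulIg (family_map 0%R)); rewrite -family_mapD addr0 mul1g.
split; first by apply: mem_set; exists 0%R.
move=> _ _ /set_mem[x _ <-] /set_mem[y _ <-]; apply: mem_set;
  exists (x - y)%R => //.
by apply: (mulIg (family_map y)); rewrite -family_mapD subrK mulgVK.
Qed.

End TwistFamily.

(** * Sides of partitions *)

Section Sides.
Variable G : sgraph.
Implicit Types (m n u v w : G) (l : lit G) (P U : {set lit G}).

(** What is used of a side P of a partition based at m: it is a union of
    inseparable sets, contains m or its inverse, and has two elements. *)
Definition link_side m P := [/\ forall l, l \in P -> l.1 \notin lk m,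
  forall l l', l.1 \notin lk m -> l'.1 \notin lk m -> adj l.1 l'.1 ->
    (l \in P) = (l' \in P),
  exists b, (m, b) \in P & 1 < #|P|].

Definition opposite m P : {set lit G} := ~: pm (lk m) :\: P.

Lemma in_pm (A : {set G}) l : (l \in pm A) = (l.1 \in A).
Proof. by rewrite inE. Qed.

Lemma in_opposite m P l :
  (l \in opposite m P) = (l \notin P) && (l.1 \notin lk m).
Proof. by rewrite /opposite finset.in_setD finset.in_setC in_pm. Qed.

Lemma pm_inj : injective (@pm G).
Proof.
move=> A B AB; apply/setP=> v.
by have /setP/(_ (v, true)) := AB; rewrite !in_pm.
Qed.

Lemma component_off (A C : {set G}) v : is_component A C -> v \in C ->
  v \notin A.
Proof.
case/existsP=> u /andP[uA /eqP->]; rewrite inE => /connectP[p pth ->].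
elim: p u uA pth => //= w p IH u uA /andP[/and3P[_ _ wA] pth].
exact: IH.
Qed.

Lemma component_adj (A C : {set G}) v w :
  is_component A C -> v \in C -> w \notin A -> adj v w -> w \in C.
Proof.
move=> cC vC wA vw; have vA := component_off cC vC.
move: cC vC => /existsP[u /andP[uA /eqP->]]; rewrite !inE => uv.
by apply: connect_trans uv (connect1 _); rewrite /= vw vA.
Qed.

Lemma inseparable_off (m : lit G) U l : inseparable m U -> l \in U ->
  l.1 \notin lk m.1.
Proof.
case/existsP=> C /andP[cC]; case/orP=> [/existsP[u /andP[/eqP CE]]|].
  move=> UE lU; apply: (component_off cC); rewrite CE.
  by case/orP: UE lU => /eqP->; rewrite !inE => /eqP->.
case/andP=> _ /eqP->; rewrite in_pm; exact: component_off.
Qed.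

Lemma inseparable_adj (m : lit G) U l l' : inseparable m U -> l \in U ->
  l'.1 \notin lk m.1 -> adj l.1 l'.1 -> l' \in U.
Proof.
move=> Um lU l'm ll'; case/existsP: (Um) => C /andP[cC].
have CC : l.1 \in C -> l'.1 \in C by move=> lC;
  apply: component_adj cC lC l'm ll'.
case/orP=> [/existsP[u /andP[/eqP CE UE]]|].
  have lu : l.1 = u by case/orP: UE lU => /eqP->; rewrite !inE => /eqP->.
  move: CC; rewrite CE !inE lu eqxx => /(_ isT)/eqP l'u.
  by move: ll'; rewrite lu l'u adj_irrefl.
by case/andP=> _ /eqP UE; move: lU; rewrite UE !in_pm.
Qed.

Lemma gw_subset_side (m : lit G) P : gw_subset m P -> 1 < #|P| ->
  1 < #|opposite m.1 P| ->
  link_side m.1 P /\ link_side m.1 (opposite m.1 P).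
Proof.
case/and3P=> /existsP[S /andP[/forallP Sm /eqP PE]] mP m'P P_gt1 Q_gt1.
have {}Sm U : U \in S -> inseparable m U by move=> US; have := Sm U; rewrite US.
have P_off l : l \in P -> l.1 \notin lk m.1.
  by rewrite PE => /finset.bigcupP[U US]; apply: inseparable_off (Sm U US).
have P_sub l l' : l'.1 \notin lk m.1 -> adj l.1 l'.1 -> l \in P -> l' \in P.
  move=> l'm ll'; rewrite PE => /finset.bigcupP[U US lU].
  by apply/finset.bigcupP; exists U => //; apply: inseparable_adj ll';
    first exact: Sm.
have P_adj l l' : l.1 \notin lk m.1 -> l'.1 \notin lk m.1 -> adj l.1 l'.1 ->
    (l \in P) = (l' \in P).
  by move=> lm l'm ll'; apply/idP/idP; apply: P_sub => //; rewrite adj_sym.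
split; split=> //.
- by exists m.2; rewrite -surjective_pairing.
- by move=> l; rewrite in_opposite => /andP[].
- by move=> l l' lm l'm ll'; rewrite !in_opposite lm l'm (P_adj l l').
- by exists (~~ m.2); rewrite in_opposite m'P in_lk adj_irrefl.
Qed.

Lemma based_at_sides (m : lit G) (p : gwpart G) : based_at m p ->
  p.2 = pm (lk m.1) /\ exists P, [/\ p.1 = [set P; opposite m.1 P],
    link_side m.1 P & link_side m.1 (opposite m.1 P)].
Proof.
case/existsP=> P /and4P[gwP P_gt1 Q_gt1 /eqP->]; split=> //.
by exists P; have [] := gw_subset_side gwP P_gt1 Q_gt1.
Qed.

Lemma opposite_lk m n P : lk m = lk n -> opposite m P = opposite n P.
Proof. by rewrite /opposite => ->. Qed.

Lemma oppositeK m P : link_side m P -> opposite m (opposite m P) = P.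
Proof.
case=> P_off _ _ _; apply/setP=> l; rewrite !in_opposite negb_and negbK.
by case: (boolP (l \in P)) => [/P_off->|] //=; case: (_ \in lk m).
Qed.

End Sides.

(** * From compatible splittings to commuting twists *)

Section SplittingFamily.
(** The i-th partition has the sides Q i and opposite (c i) (Q i), and c i is a
    vertex at which it is based. The vertex b i is the representative, common
    to all partitions with the same link, that serves as base of the twist; the
    partition itself need not be based at b i. *)
Variables (G : sgraph) (r : nat) (b c : 'I_r -> G) (Q : 'I_r -> {set lit G}).

Hypothesis b_principal : forall i, principal (b i).
Hypothesis b_link : forall i j, lk (b i) = lk (b j) -> b i = b j.
Hypothesis c_link : forall i, lk (c i) = lk (b i).
Hypothesis Q_side : forall i, link_side (c i) (Q i).
Hypothesis Q_opposite : forall i, link_side (c i) (opposite (c i) (Q i)).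
Hypothesis Q_base : forall i, (b i, false) \notin Q i.
Hypothesis Q_inj : forall i j, b i = b j -> Q i = Q j -> i = j.
Hypothesis Q_compat : forall i j, i != j -> adj (b i) (b j) \/
  exists P P', [/\ P \in [set Q i; opposite (c i) (Q i)],
     P' \in [set Q j; opposite (c j) (Q j)] & [disjoint P & P']].

Implicit Types (m : G) (l x y : lit G) (i j k : 'I_r).

Definition same_sides m l l' :=
  [forall k, (b k == m) ==> ((l \in Q k) == (l' \in Q k))].

Definition same_link m l := lk l.1 == lk m.

(** Literals on the same side as another base n for all partitions of the group
    of m are merged, so that a twist constant on classes gives them the value
    of n. The literals with the link of m are kept apart: they share the class
    of m for n, so twists with base n treat them like m anyway. *)
Definition merged m l l' := [&& ~~ same_link m l, ~~ same_link m l',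
  same_sides m l l' & [exists j, (b j \notin st m) && same_sides m l (b j, true)]].

Definition tied m : rel (lit G) := fun l l' =>
  [&& l.1 \notin lk m, l'.1 \notin lk m & adj l.1 l'.1 || merged m l l'].

Definition conn m := connect (tied m).

Lemma same_sidesP m l l' :
  reflect (forall k, b k = m -> (l \in Q k) = (l' \in Q k)) (same_sides m l l').
Proof.
apply: (iffP forallP) => [h k bk|h k]; first by have := h k;
  rewrite bk eqxx => /eqP.
by apply/implyP=> /eqP bk; rewrite h.
Qed.

Lemma same_sides_sym m l l' : same_sides m l l' = same_sides m l' l.
Proof. by apply/same_sidesP/same_sidesP => h k bk; rewrite h. Qed.

Lemma same_sides_trans m l1 l2 l3 :
  same_sides m l1 l2 -> same_sides m l2 l3 -> same_sides m l1 l3.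
Proof. by move=> /same_sidesP h /same_sidesP h'; apply/same_sidesP=> k bk;
  rewrite h ?h'. Qed.

Lemma tied_sym m : symmetric (tied m).
Proof.
suff sub l l' : tied m l l' -> tied m l' l by move=> l l'; apply/idP/idP;
  apply: sub.
case/and3P=> lm l'm t; rewrite /tied lm l'm /= adj_sym.
case/orP: t => [->//|/and4P[nl nl' ll' /existsP[j /andP[jm lj]]]].
apply/orP; right; rewrite /merged nl nl' same_sides_sym ll' /=.
apply/existsP; exists j; rewrite jm; apply: same_sides_trans lj.
by rewrite same_sides_sym.
Qed.

Lemma conn_sym m : connect_sym (tied m).
Proof. exact/sym_connect_sym/tied_sym. Qed.

Lemma conn_ind m (P : lit G -> Prop) l : P l ->
  (forall x y, P x -> tied m x y -> P y) -> forall l', conn m l l' -> P l'.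
Proof.
move=> Pl Pt l' /connectP[p pth ->];
  elim: p l Pl pth => //= x p IH l Pl /andP[lx].
by apply: IH; apply: Pt lx.
Qed.

Lemma conn_isolated m l l' : same_link m l -> conn m l l' -> l' = l.
Proof.
move=> lm; apply: (conn_ind (P := fun x => x = l)) => // x y -> /and3P[_ ym].
rewrite /merged lm /= orbF => ly; move: ym.
by rewrite -(eqP lm) in_lk ly.
Qed.

Lemma conn_off_link m l l' : l.1 \notin lk m -> conn m l l' -> l'.1 \notin lk m.
Proof. by move=> lm; apply: (conn_ind (P :=
  fun x => x.1 \notin lk m)) => // x y _ /and3P[]. Qed.

Lemma conn_side k l l' : conn (b k) l l' -> (l \in Q k) = (l' \in Q k).
Proof.
apply: (conn_ind (P := fun x => (l \in Q k) = (x \in Q k))) => // x y ->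
  /and3P[xm ym /orP[xy|/and4P[_ _ /same_sidesP-> //]]].
have [_ Q_adj _ _] := Q_side k.
by apply: Q_adj; rewrite ?c_link.
Qed.

Lemma conn_opposite k l l' : l.1 \notin lk (b k) -> conn (b k) l l' ->
  (l \in opposite (c k) (Q k)) = (l' \in opposite (c k) (Q k)).
Proof.
move=> lk ll'; rewrite !in_opposite (conn_side ll') c_link lk.
by rewrite (conn_off_link lk ll').
Qed.

Definition reps m : {set lit G} := [set x :
  lit G | (x.1 \notin lk m) && (fingraph.root (tied m) x == x)].

Lemma root_reps m l : l.1 \notin lk m -> fingraph.root (tied m) l \in reps m.
Proof.
move=> lm; rewrite inE (conn_off_link lm (fingraph.connect_root _ _)) /=.
exact: (fingraph.roots_root (conn_sym m)).
Qed.

Lemma reps_conn m x y : x \in reps m -> y \in reps m -> conn m x y -> x = y.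
Proof.
rewrite !inE => /andP[_ /eqP xr] /andP[_ /eqP yr].
by rewrite /conn -(root_connect (conn_sym m)) xr yr => /eqP.
Qed.

Lemma isolated_reps m l : same_link m l -> l \in reps m.
Proof.
move=> lm; rewrite inE -(eqP lm) in_lk adj_irrefl /=; apply/eqP.
by apply: conn_isolated lm (fingraph.connect_root _ _).
Qed.

(** P contains the isolated literal (n, d), a class by itself, and another
    literal, whose class is therefore a second one. *)
Lemma card_reps_closed (P : {set lit G}) m n d : same_link m (n, d) ->
  (n, d) \in P ->
  (forall l, l \in P -> l.1 \notin lk m) ->
  (forall l l', l.1 \notin lk m -> conn m l l' -> (l \in P) = (l' \in P)) ->
  1 < #|P| -> 1 < #|P :&: reps m|.
Proof.
move=> nm nP P_off P_conn /card_gt1P[x [y [xP yP xy]]].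
have [z zP zn] : exists2 z, z \in P & z != (n, d).
  have [xn|xn] := eqVneq x (n, d); last by exists x.
  by exists y => //; rewrite -xn eq_sym.
have rz : conn m z (fingraph.root (tied m) z) by apply: fingraph.connect_root.
apply/card_gt1P; exists (n, d), (fingraph.root (tied m) z); split.
- by rewrite inE nP isolated_reps.
- by rewrite inE -(P_conn z) ?P_off // zP root_reps ?P_off.
- apply: contraNneq zn => nz; rewrite (conn_isolated nm (l' := z)) //.
  by rewrite nz /conn (conn_sym m).
Qed.

Lemma card_reps_side k : 1 < #|Q k :&: reps (b k)|.
Proof.
have [Q_off _ [d dQ] Q_gt1] := Q_side k.
apply: (card_reps_closed (n := c k) (d := d)) => //;
  first by rewrite /same_link c_link.
  by move=> l /Q_off; rewrite c_link.
by move=> l l' _; apply: conn_side.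
Qed.

Lemma card_reps_opposite k : 1 < #|opposite (c k) (Q k) :&: reps (b k)|.
Proof.
have [Q_off _ [d dQ] Q_gt1] := Q_opposite k.
apply: (card_reps_closed (n := c k) (d := d)) => //;
  first by rewrite /same_link c_link.
  by move=> l /Q_off; rewrite c_link.
exact: conn_opposite.
Qed.

(** Q i and Q j avoid the same literal (b i, false), so the opposite sides are
    not disjoint; each other choice of disjoint sides is an alternative. *)
Lemma Q_laminar i j : b i = b j ->
  [\/ Q i \subset Q j, Q j \subset Q i | [disjoint Q i & Q j]].
Proof.
move=> bij; have [->|ij] := eqVneq i j; first by constructor 1.
have sub k k' : b k = b k' -> [disjoint Q k & opposite (c k') (Q k')] ->
    Q k \subset Q k'.
  move=> bk dis; have [Qk_off _ _ _] := Q_side k; apply/subsetP=> l lk.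
  have := disjointFr dis lk; rewrite in_opposite c_link -bk -c_link Qk_off //.
  by rewrite andbT => /negbFE.
case: (Q_compat ij) => [|[P [P' []]]]; first by rewrite bij adj_irrefl.
rewrite !inE => /orP[]/eqP-> /orP[]/eqP-> dis.
- by constructor 3.
- by constructor 1; apply: sub.
- by constructor 2; apply: sub => //; rewrite disjoint_sym.
have opp k : b k = b i -> (b i, false) \in opposite (c k) (Q k).
  by move=> <-; rewrite in_opposite Q_base c_link in_lk adj_irrefl.
by have := disjointFr dis (opp i erefl); rewrite opp.
Qed.

Definition group_of m : {set 'I_r} := [set k | b k == m].
Definition free_reps m : {set lit G} := reps m :\ (m, true) :\ (m, false).

(** The traces of the sides Q k on the representatives form a laminar family on
    the set E of all representatives except (m, false). E itself can be added,
    because the opposite sides contain two representatives each. The bound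
    gives k + 1 <= #|E| - 1, and E has one element more than [free_reps m]. *)
Lemma card_free_reps i : #|group_of (b i)| < #|free_reps (b i)|.
Proof.
set m := b i; set K := group_of m; pose E := reps m :\ (m, false).
pose tr k := Q k :&: reps m.
have KE k : k \in K -> b k = m by rewrite inE => /eqP.
have trE k : k \in K -> tr k \subset E.
  move=> kK; apply/subsetP=> l; rewrite !inE => /andP[lQ ->]; rewrite andbT.
  by apply: contraTneq lQ => ->; rewrite -(KE k kK) Q_base.
have mem_root k l : k \in K -> l.1 \notin lk m ->
    (l \in Q k) = (fingraph.root (tied m) l \in tr k).
  move=> kK lm; rewrite inE root_reps // andbT.
  by apply: conn_side; rewrite (KE k kK); exact: fingraph.connect_root.
have tr_inj : {in K &, injective tr}.
  move=> k k' kK k'K eq_tr; apply: Q_inj; first by rewrite !KE.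
  apply/setP=> l; have [Qk_off _ _ _] := Q_side k;
    have [Qk'_off _ _ _] := Q_side k'.
  have [lm|lm] := boolP (l.1 \in lk m); last by rewrite !mem_root // eq_tr.
  by apply/idP/idP => [/Qk_off|/Qk'_off]; rewrite c_link KE // lm.
have E_new k : k \in K -> E != tr k.
  move=> kK; apply/eqP=> Etr.
  have /card_gt1P[x [y [xO yO xy]]] := card_reps_opposite k.
  have outside z : z \in opposite (c k) (Q k) :&: reps (b k) -> z = (m, false).
    rewrite (KE k kK) => /setIP[zO zr]; apply/eqP.
    have : z \notin E.
      rewrite Etr finset.in_setI negb_and.
      by move: zO; rewrite in_opposite => /andP[->].
    by rewrite finset.in_setD1 zr andbT negbK.
  by move: xy; rewrite (outside x xO) (outside y yO) eqxx.
pose F := E |: (tr @: K).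
have /laminar_bound : laminar F.
  move=> A B; rewrite !inE => /orP[/eqP->|/imsetP[k kK ->]].
    case/orP=> [/eqP->|/imsetP[k kK ->]]; first by constructor 1.
    by constructor 2; exact: trE.
  case/orP=> [/eqP->|/imsetP[k' k'K ->]]; first by constructor 1; exact: trE.
  have bkk : b k = b k' by rewrite !KE.
  case: (Q_laminar bkk) => h; [constructor 1|constructor 2|constructor 3].
  - exact: setSI.
  - exact: setSI.
  - exact: disjointWl (subsetIl _ _) (disjointWr (subsetIl _ _) h).
have iK : i \in K by rewrite inE.
have tr_gt1 k : k \in K -> 1 < #|tr k| by move=> kK; have := card_reps_side k;
  rewrite KE.
move=> /(_ E) bound; have {bound} : #|F| <= #|E|.-1.
  apply: bound => A; rewrite !inE => /orP[/eqP->|/imsetP[k kK ->]].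
    split=> //; apply: leq_trans (tr_gt1 i iK) (subset_leq_card (trE i iK)).
  by split; [exact: trE|exact: tr_gt1].
have EF : E \notin tr @: K by apply/negP=> /imsetP[k kK /eqP];
  rewrite (negPf (E_new k kK)).
rewrite cardsU1 EF card_in_imset // add1n.
have Em : (m, true) \in E.
  by rewrite finset.in_setD1 xpair_eqE andbF; apply: isolated_reps; exact: eqxx.
have -> : free_reps m = E :\ (m, true).
  by apply/setP=> l; rewrite !inE andbCA.
by rewrite (cardsD1 (m, true) E) Em.
Qed.

Definition chosen i : lit G :=
  nth (b i, true) (enum (free_reps (b i))) (index i (enum (group_of (b i)))).

(** The class left out of the twists with base b i, which normalizes the
    functions that are otherwise defined up to a constant. *)
Definition spare i : lit G :=
  nth (b i, true) (enum (free_reps (b i))) #|group_of (b i)|.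

Lemma index_group i : index i (enum (group_of (b i))) < #|group_of (b i)|.
Proof. by rewrite cardE index_mem mem_enum inE. Qed.

Lemma chosen_mem i : chosen i \in free_reps (b i).
Proof.
rewrite -mem_enum mem_nth // -cardE.
exact: ltn_trans (index_group i) (card_free_reps i).
Qed.

Lemma spare_mem i : spare i \in free_reps (b i).
Proof. by rewrite -mem_enum mem_nth // -cardE card_free_reps. Qed.

Lemma chosen_inj i j : b i = b j -> chosen i = chosen j -> i = j.
Proof.
move=> bij; rewrite /chosen -bij => /eqP.
have j_idx : index j (enum (group_of (b i))) < #|group_of (b i)|.
  by rewrite bij index_group.
have := card_free_reps i => lt.
rewrite nth_uniq ?enum_uniq // -?cardE; last 2 first.
- exact: ltn_trans (index_group i) lt.
- exact: ltn_trans j_idx lt.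
have jK : j \in enum (group_of (b i)) by rewrite mem_enum inE bij.
have iK : i \in enum (group_of (b i)) by rewrite mem_enum inE.
by move/eqP => e; rewrite -(nth_index i iK) e nth_index.
Qed.

Lemma chosen_spare i j : b j = b i -> chosen j <> spare i.
Proof.
move=> bij; rewrite /chosen /spare bij => /eqP.
have j_idx : index j (enum (group_of (b i))) < #|group_of (b i)|.
  by rewrite -bij index_group.
have := card_free_reps i => lt.
rewrite nth_uniq ?enum_uniq // -?cardE //; last exact: ltn_trans j_idx lt.
by rewrite (ltn_eqF j_idx).
Qed.

Lemma free_reps_off m l : l \in free_reps m -> l.1 \notin st m.
Proof.
case: l => v d; rewrite !inE !xpair_eqE negb_or /= => /and3P[vf vt /andP[vm _]].
by rewrite vm andbT; move: vf vt; case: (v == m); case: d.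
Qed.

Lemma free_reps_reps m l : l \in free_reps m -> l \in reps m.
Proof. by rewrite !finset.in_setD => /and3P[]. Qed.

Definition chosen_class i : {set lit G} := [set l | conn (b i) (chosen i) l].

Lemma in_chosen_class i l : (l \in chosen_class i) = conn (b i) (chosen i) l.
Proof. by rewrite inE. Qed.

Lemma conn_off_star m l l' : l \in free_reps m -> conn m l l' ->
  l'.1 \notin st m.
Proof.
move=> lf ll'; have lm := free_reps_off lf.
have l'm : l'.1 \notin lk m.
  by apply: conn_off_link ll'; move: lm; rewrite in_st negb_or in_lk => /andP[].
rewrite in_st negb_or -in_lk l'm andbT; apply: contraNneq lm => l'E.
have same : same_link m l' by rewrite /same_link l'E.
rewrite (conn_isolated (l' := l) same) ?l'E ?in_st ?eqxx //.
by rewrite /conn (conn_sym m).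
Qed.

Lemma conn_adj m l l' : l.1 \notin lk m -> l'.1 \notin lk m -> adj l.1 l'.1 ->
  conn m l l'.
Proof. by move=> lm l'm ll'; apply: connect1; rewrite /tied lm l'm ll'. Qed.

(** Distinct representatives have distinct links, and the link of a principal
    vertex is not properly contained in another one. *)
Lemma link_witness i j : b j \notin st (b i) ->
  exists2 w, adj (b j) w & w \notin lk (b i).
Proof.
move=> ji; have : ~~ (lk (b j) \subset lk (b i)).
  apply: contra (b_principal j) => sub; apply/existsP; exists (b i).
  rewrite properEneq sub andbT; apply: contraNneq ji => /b_link->.
  by rewrite in_st eqxx.
by case/subsetPn=> w; rewrite in_lk; exists w.
Qed.

(** A common neighbour w of b j and l off the link of b i ties them together.
    *)
Lemma conn_base i j l (d : bool) : b j \notin st (b i) -> same_link (b j) l ->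
  conn (b i) l (b j, d).
Proof.
move=> ji lj; have [w jw wi] := link_witness ji.
have jNi : b j \notin lk (b i) by move: ji;
  rewrite in_st negb_or in_lk => /andP[].
have lw : adj l.1 w by rewrite -in_lk (eqP lj) in_lk.
have li : l.1 \notin lk (b i).
  rewrite in_lk adj_sym -in_lk (eqP lj) in_lk adj_sym -in_lk //.
apply: (connect_trans (y := (w, true))); apply: conn_adj => //=.
by rewrite adj_sym.
Qed.

Lemma partition_side p (P : {set lit G}) : P \in [set Q p;
  opposite (c p) (Q p)] ->
  [/\ link_side (c p) P,
    forall x y, x.1 \notin lk (b p) -> conn (b p) x y -> (x \in P) = (y \in P) &
    forall x y, x.1 \notin lk (b p) -> y.1 \notin lk (b p) ->
      (x \in Q p) != (y \in Q p) -> (x \in P) != (y \in P)].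
Proof.
rewrite !inE => /orP[]/eqP->; split=> // x y.
- by move=> _; exact: conn_side.
- exact: conn_opposite.
- move=> xp yp; rewrite !in_opposite c_link xp yp !andbT.
  by case: (x \in Q p); case: (y \in Q p).
Qed.

(** Otherwise some partition p of the group of b i separates l from b j, and
    some q of the group of b j separates l from b i. Let P and P' be sides of p
    and q. If b i lies in P', then so do all literals with the link of b i, and
    P contains one of them; symmetrically if b j lies in P; in the remaining
    case l lies in both. So no side of p is disjoint from a side of q. *)
Lemma conn_far i j l : b j \notin st (b i) ->
  l.1 \notin st (b i) -> l.1 \notin st (b j) ->
  conn (b i) l (b j, true) \/ conn (b j) l (b i, true).
Proof.
move=> ji li lj.
have ij : b i \notin st (b j) by move: ji; rewrite !in_st eq_sym adj_sym.
have [lsj|lsj] := boolP (same_link (b j) l); first by left; apply: conn_base.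
have [lsi|lsi] := boolP (same_link (b i) l); first by right; apply: conn_base.
have jsi : ~~ same_link (b i) (b j, true).
  by apply: contra ji => /eqP/b_link->; rewrite in_st eqxx.
have isj : ~~ same_link (b j) (b i, true).
  by apply: contra ij => /eqP/b_link->; rewrite in_st eqxx.
have st_lk m v : v \notin st m -> v \notin lk m.
  by rewrite in_st negb_or in_lk => /andP[].
have [si|si] := boolP (same_sides (b i) l (b j, true)).
  left; apply: connect1; rewrite /tied !st_lk //=; apply/orP; right.
  by rewrite /merged lsi jsi si; apply/existsP; exists j; rewrite ji.
have [sj|sj] := boolP (same_sides (b j) l (b i, true)).
  right; apply: connect1; rewrite /tied !st_lk //=; apply/orP; right.
  by rewrite /merged lsj isj sj; apply/existsP; exists i; rewrite ij.
have separated k x : ~~ same_sides (b k) l x ->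
    exists2 k', b k' = b k & (l \in Q k') != (x \in Q k').
  by case/forallPn=> k'; rewrite negb_imply => /andP[/eqP]; exists k'.
have [p bp lp] := separated i _ si; have [q bq lq] := separated j _ sj.
have pq : p != q.
  by apply: contraNneq ji => pq; rewrite -bp pq bq in_st eqxx.
case: (Q_compat pq) => [|[P [P' [Pp P'q dis]]]].
  by rewrite bp bq => ij'; move: ji; rewrite in_st ij' orbT.
exfalso; have meet x : x \in P -> x \in P' -> False.
  by move=> xP; rewrite (disjointFr dis xP).
have [[_ _ [d dP] _] P_conn P_sep] := partition_side Pp.
have [[_ _ [d' dP'] _] P'_conn P'_sep] := partition_side P'q.
rewrite bp in P_conn P_sep; rewrite bq in P'_conn P'_sep.
have [iP'|iP'] := boolP ((b i, true) \in P').
  have cpi : same_link (b i) (c p, d) by rewrite /same_link c_link bp.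
  apply: (meet (c p, d)) => //; rewrite (P'_conn _ _ _ (conn_base true ij cpi)) //=.
  rewrite in_lk adj_sym -in_lk c_link bp in_lk adj_sym -in_lk; exact: st_lk.
have [jP|jP] := boolP ((b j, true) \in P).
  have cqj : same_link (b j) (c q, d') by rewrite /same_link c_link bq.
  apply: (meet (c q, d')) => //; rewrite (P_conn _ _ _ (conn_base true ji cqj)) //=.
  rewrite in_lk adj_sym -in_lk c_link bq in_lk adj_sym -in_lk; exact: st_lk.
apply: (meet l).
  have := P_sep l (b j, true) (st_lk _ _ li) (st_lk _ _ ji) lp.
  by rewrite (negPf jP); case: (l \in P).
have := P'_sep l (b i, true) (st_lk _ _ lj) (st_lk _ _ ij) lq.
by rewrite (negPf iP'); case: (l \in P').
Qed.

Lemma splitting_family_free_abelian : exists H : set (out (raag G)),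
  classical_sets.subset H (untwisted G) /\ free_abelian_subgroup r H.
Proof.
have connE i l l' : conn (b i) l l' ->
    (l \in chosen_class i) = (l' \in chosen_class i).
  move=> ll'; rewrite !in_chosen_class.
  exact: (same_connect_r (conn_sym (b i)) ll').
have chosen_off i l : l \in chosen_class i -> l.1 \notin st (b i).
  by rewrite in_chosen_class; apply: conn_off_star (chosen_mem i).
apply: (@twist_family_free_abelian G r b chosen_class).
- exact: chosen_off.
- by move=> i; exists (chosen i); rewrite in_chosen_class; exact: connect0.
- move=> i v w d d' vi wi vw; apply/connE/conn_adj => //=.
    by move: vi; rewrite in_st negb_or in_lk => /andP[].
  by move: wi; rewrite in_st negb_or in_lk => /andP[].
- by move=> i j ji; apply/connE/conn_base => //; rewrite /same_link.
- move=> i j ji l li lj.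
  by case: (conn_far ji li lj) => h; [left|right]; apply: connE.
- move=> i j bij ij; apply/pred0P=> l /=; apply/negP.
  rewrite !in_chosen_class bij => /andP[il jl].
  case/negP: ij; apply/eqP/(chosen_inj bij)/(reps_conn (m := b j)).
  + by rewrite -bij; exact/free_reps_reps/chosen_mem.
  + exact/free_reps_reps/chosen_mem.
  + by apply: connect_trans il _; rewrite (conn_sym (b j)).
- move=> i; exists (spare i); split; first exact/free_reps_off/spare_mem.
  move=> j bji; rewrite in_chosen_class; apply/negP=> js.
  apply: (chosen_spare bji); apply: (reps_conn (m := b j)) js.
    exact/free_reps_reps/chosen_mem.
  by rewrite bji; exact/free_reps_reps/spare_mem.
Qed.

End SplittingFamily.

(** * Collections of maximal size *)

Section MaximalCollection.
Variable G : sgraph.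
Implicit Types p q : gwpart G.

Lemma M_attained (U : {set G}) : exists S : {set gwpart G},
  [/\ #|S| = M U, compatible_collection S &
      forall p, p \in S -> exists2 u, u \in U & based_at_vertex u p].
Proof.
pose ok (S : {set gwpart G}) := compatible_collection S
  && [forall p in S, [exists u in U, based_at_vertex u p]].
have ok0 : ok finset.set0.
  by rewrite /ok /compatible_collection -andbA; apply/and3P; split; [| |];
    apply/forallP=> p; rewrite inE.
have ok_gt0 : 0 < #|ok| by apply/card_gt0P; exists finset.set0.
have [S /andP[compS /forallP baseS] MS] :=
  eq_bigmax_cond (fun S : {set gwpart G} => #|S|) ok_gt0.
exists S; split=> // p pS; have := baseS p; rewrite pS => /exists_inP[u uU pu].
by exists u.
Qed.

(** In the commuting case the bases are adjacent, not equal, because their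
    stars differ; adjacency then passes to all vertices with the same links. *)
Lemma compatible_sides p q m n : p.2 = pm (lk m) -> q.2 = pm (lk n) ->
  compatible p q -> adj m n \/
  exists P P', [/\ P \in p.1, P' \in q.1 & [disjoint P & P']].
Proof.
move=> pm_p pm_q /orP[/exists_inP[P Pp /exists_inP[P' P'q dis]]|].
  by right; exists P, P'.
case/existsP=> m' /existsP[n' /and4P[/based_at_sides[pm' _] /based_at_sides[qn' _]]].
have lm : lk m'.1 = lk m by apply: pm_inj; rewrite -pm_p.
have ln : lk n'.1 = lk n by apply: pm_inj; rewrite -pm_q.
case/orP=> [/eqP->|mn _]; first by rewrite eqxx.
by left; rewrite adj_sym -in_lk -ln in_lk adj_sym -in_lk -lm in_lk.
Qed.

(** The side that avoids (b i, false) is taken as Q i, which makes the family Q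
    laminar for each base. *)
Lemma compatible_collection_free_abelian (S : {set gwpart G}) :
  compatible_collection S ->
  (forall p, p \in S -> exists2 u, principal u & based_at_vertex u p) ->
  exists H : set (out (raag G)),
    classical_sets.subset H (untwisted G) /\ free_abelian_subgroup #|S| H.
Proof.
case/andP=> _ /forallP compS baseS.
pose p (i : 'I_#|S|) : gwpart G := enum_val i.
have pS i : p i \in S by exact: enum_valP.
have /fin_all_exists[c c_spec] i :
  exists u, [/\ principal u, (p i).2 = pm (lk u) &
    exists P, [/\ (p i).1 = [set P; opposite u P], link_side u P &
      link_side u (opposite u P)]].
  have [u pu] := baseS _ (pS i).
  by case/orP=> /based_at_sides[pi2 sides_pi]; exists u.
pose b i := odflt (c i) [pick v | pm (lk v) == (p i).2].
have c_link i : lk (c i) = lk (b i).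
  have [_ pi2 _] := c_spec i; rewrite /b; case: pickP => //= v /eqP.
  by rewrite pi2 => /pm_inj.
have p_link i : (p i).2 = pm (lk (b i)) by rewrite -c_link; have [] := c_spec i.
have b_link i j : lk (b i) = lk (b j) -> b i = b j.
  move=> bij; have pij : (p i).2 = (p j).2 by rewrite !p_link bij.
  rewrite /b pij; case: pickP => //= none.
  by have := none (b j); rewrite p_link eqxx.
have b_principal i : principal (b i).
  have [pc _ _] := c_spec i; apply: contra pc => /existsP[w].
  by rewrite -c_link => cw; apply/existsP; exists w.
have /fin_all_exists[Q Q_spec] i : exists P :
  {set lit G}, [/\ (b i, false) \notin P,
    (p i).1 = [set P; opposite (c i) P], link_side (c i) P &
    link_side (c i) (opposite (c i) P)].
  have [_ _ [P [pE Ps Os]]] := c_spec i.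
  have [bP|bP] := boolP ((b i, false) \in P); last by exists P.
  exists (opposite (c i) P); rewrite in_opposite bP; split=> //.
    by rewrite oppositeK // finset.setUC.
  by rewrite oppositeK.
apply: (@splitting_family_free_abelian G #|S| b c Q) => //.
- by move=> i; have [] := Q_spec i.
- by move=> i; have [] := Q_spec i.
- by move=> i; have [] := Q_spec i.
- move=> i j bij Qij; apply: enum_val_inj; rewrite -/(p i) -/(p j).
  have [_ pi _ _] := Q_spec i; have [_ pj _ _] := Q_spec j.
  rewrite [p i]surjective_pairing [p j]surjective_pairing pi pj !p_link bij Qij.
  by rewrite (opposite_lk (n := c j)) // !c_link bij.
- move=> i j ij; have [_ pi _ _] := Q_spec i; have [_ pj _ _] := Q_spec j.
  rewrite -pi -pj; apply: compatible_sides => //.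
  have := compS (p i); rewrite pS /= => /forallP/(_ (p j)); rewrite pS /=.
  by move/implyP; apply; apply: contraNneq ij => /enum_val_inj->.
Qed.

End MaximalCollection.

(* From here on [subset] is the inclusion of classical sets. *)
From mathcomp Require Import classical_sets.

Theorem theorem4p25 (G : sgraph) :
  exists H : set (out (raag G)),
    subset H (untwisted G) /\
    free_abelian_subgroup (M (principal_set G)) H.
Proof.
have [S [<- compS baseS]] := M_attained (principal_set G).
apply: compatible_collection_free_abelian compS _ => p /baseS[u].
by rewrite inE; exists u.
Qed.
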